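(* Let $X$ be a paracompact Hausdorff space. The following are equivalent: (a) $X$ is a $C$-space. (b) For every Hausdorff space $Y$, each aspherical sequence $\varphi_n:X\leadsto Y$, $n<\omega$, of lower locally constant mappings admits a continuous selection for its union $\bigcup_{n<\omega}\varphi_n$. (c) Each sequence $\mathscr{U}_n$, $n<\omega$, of open covers of $X$ admits a canonical map $f:X\to|\Delta(\mathscr{U}_{<\omega})|$.
   Context: $C$-space: for any sequence $\{\mathscr{U}_n:n<\omega\}$ of open covers of $X$ there is a sequence $\{\mathscr{V}_n:n<\omega\}$ of pairwise-disjoint families of open subsets of $X$ such that each $\mathscr{V}_n$ refines $\mathscr{U}_n$ (every member of $\mathscr{V}_n$ is contained in some member of $\mathscr{U}_n$) and $\bigcup_{n<\omega}\mathscr{V}_n$ covers $X$. Set-valued mappings: $\Phi:X\leadsto Y$ is a map from $X$ to the nonempty subsets of $Y$; $f:X\to Y$ is a selection for $\Phi$ if $f(x)\in\Phi(x)$ for all $x$; $\Phi$ is lower locally constant if $\{x\in X:K\subset\Phi(x)\}$ is open in $X$ for every compact $K\subset Y$. For $S,B\subset Y$ and $k\ge0$, $S\stackrel{k}{\hookrightarrow}B$ means every continuous map from the $k$-sphere to $S$ extends to a continuous map from the $(k+1)$-ball to $B$; $\varphi\stackrel{k}{\hookrightarrow}\psi$ means $\varphi(x)\stackrel{k}{\hookrightarrow}\psi(x)$ for all $x\in X$. The sequence $\varphi_n$, $n<\omega$, is aspherical if $\varphi_n\stackrel{n}{\hookrightarrow}\varphi_{n+1}$ for every $n<\omega$. The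 union $\bigcup_{n<\omega}\varphi_n$ is defined pointwise. Simplicial complexes: a simplicial complex is a collection $\Sigma$ of nonempty finite sets closed under taking nonempty subsets. Embedding the vertices as a linearly independent subset of a normed linear space, $|\sigma|$ is the convex hull of $\sigma\in\Sigma$, and $|\Sigma|=\bigcup_{\sigma\in\Sigma}|\sigma|$ is the geometric realisation with the Whitehead topology ($U$ is open iff $U\cap|\sigma|$ is open in $|\sigma|$ for every $\sigma\in\Sigma$). $\langle\sigma\rangle$ is the relative interior of $|\sigma|$, and $\mathrm{st}\langle v\rangle=\bigcup_{v\in\sigma\in\Sigma}\langle\sigma\rangle$ is the open star of a vertex $v$. $\Delta(\mathscr{U}_{<\omega})$: regard the disjoint union $\bigcup_{n<\omega}\mathscr{U}_n\times\{n\}$ as an indexed cover of $X$, the index $(U,n)$ representing the set $U$. For a nonempty finite set $\sigma$ of indices, $\ker[\sigma]=\bigcap_{(U,n)\in\sigma}U$. The nerve $\mathscr{N}(\mathscr{U}_{<\omega})$ consists of all such $\sigma$ with $\ker[\sigma]\ne\varnothing$, and $\Delta(\mathscr{U}_{<\omega})$ is the subcomplex of those $\sigma$ containing at most one element of $\mathscr{U}_n\times\{n\}$ for each $n<\omega$. Canonical map: a continuous map $f:X\to|\Delta(\mathscr{U}_{<\omega})|\subset|\mathscr{N}(\mathscr{U}_{<\omega})|$ is canonical if $f^{-1}(\mathrm{st}\langle(U,n)\rangle)\subset U$ for every vertex $(U,n)$. *)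

(* Defs.v *)
From HB Require Import structures.
From mathcomp Require Import all_boot all_order all_algebra finmap.
From mathcomp Require Import all_classical all_reals all_analysis.

Set Implicit Arguments.
Unset Strict Implicit.
Unset Printing Implicit Defensive.

Import Order.TTheory GRing.Theory Num.Theory numFieldNormedType.Exports.
Local Open Scope classical_set_scope.
Local Open Scope ring_scope.

Section Covers.
Variable X : topologicalType.

Definition open_cover (C : set (set X)) :=
  (forall A, C A -> open A) /\ \bigcup_(A in C) A = setT.

Definition refines (D C : set (set X)) :=
  forall B, D B -> exists2 A, C A & B `<=` A.

Definition locally_finite (C : set (set X)) :=
  forall x : X, exists2 N, nbhs x N & finite_set [set A | C A /\ A `&` N !=set0].

Definition paracompact :=
  forall C, open_cover C ->
    exists D, [/\ open_cover D, refines D C & locally_finite D].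

Definition C_space :=
  forall U : nat -> set (set X), (forall n, open_cover (U n)) ->
  exists V : nat -> set (set X),
    [/\ forall n A, V n A -> open A,
        forall n, trivIset (V n) id,
        forall n, refines (V n) (U n)
      & \bigcup_n \bigcup_(A in V n) A = setT].

End Covers.

Section SetValuedMappings.
Variables X Y : topologicalType.

Definition set_valued (Phi : X -> set Y) := forall x, Phi x !=set0.

Definition selection (Phi : X -> set Y) (f : X -> Y) := forall x, Phi x (f x).

Definition lower_locally_constant (Phi : X -> set Y) :=
  forall K : set Y, compact K -> open [set x | K `<=` Phi x].

End SetValuedMappings.

Section Asphericity.
Variable R : realType.

(* The topology of 'rV[R]_k.+1 is the Euclidean one, but its library norm is
   the sup norm, hence the explicit sums of squares. *)
Definition sphere k : set 'rV[R]_k.+1 := [set x | \sum_i x 0 i ^+ 2 = 1].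

Definition unit_ball k : set 'rV[R]_k.+1 := [set x | \sum_i x 0 i ^+ 2 <= 1].

Arguments sphere : clear implicits.
Arguments unit_ball : clear implicits.

(* Maps on the sphere and the ball are represented by total functions on
   'rV[R]_k.+1, of which only the restrictions matter. *)
Definition sphere_extends (Y : topologicalType) k (S B : set Y) :=
  forall g : 'rV[R]_k.+1 -> Y,
    {within sphere k, continuous g} -> (forall x, sphere k x -> S (g x)) ->
  exists h : 'rV[R]_k.+1 -> Y,
    [/\ {within unit_ball k, continuous h},
        forall x, unit_ball k x -> B (h x)
      & forall x, sphere k x -> h x = g x].

Definition aspherical (X Y : topologicalType) (phi : nat -> X -> set Y) :=
  forall n x, sphere_extends n (phi n x) (phi n.+1 x).

End Asphericity.

Record complex (V : choiceType) := Complex {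
  simplices : set {fset V} ;
  simplex_neq0 : forall s, simplices s -> s != fset0 ;
  simplex_face : forall s t, simplices s ->
    (t `<=` s)%fset -> t != fset0 -> simplices t
}.

(* The normed space in which vertices are embedded: finitely supported
   functions V -> R with the l^1 norm, the vertex v being sent to the
   indicator function of v. *)
Section VertexSpace.
Variables (R : realType) (V : choiceType).

Definition finitely_supported : {pred V -> R} :=
  mem [set x : V -> R | finite_set [set v | x v != 0]].

Fact finitely_supported_submod : submod_closed finitely_supported.
Proof.
split; first by rewrite inE/=; apply: (sub_finite_set _ (finite_set0 V)) => v /=; rewrite eqxx.
move=> a x y; rewrite !inE/= => fx fy.
apply: (@sub_finite_set _ _ ([set v | x v != 0] `|` [set v | y v != 0])).
  move=> v /=; apply: contra_neqP => /not_orP[/negP/negPn/eqP xv /negP/negPn/eqP yv].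
  have -> : (a *: x + y) v = a * x v + y v by [].
  by rewrite xv yv mulr0 addr0.
by rewrite finite_setU.
Qed.

HB.instance Definition _ :=
  GRing.isSubmodClosed.Build R (V -> R) finitely_supported
    finitely_supported_submod.

Record vertex_space := VertexSpace {
  coord :> V -> R ;
  coordP : coord \in finitely_supported
}.

HB.instance Definition _ := [isSub for coord].
HB.instance Definition _ := [Choice of vertex_space by <:].
HB.instance Definition _ := [SubChoice_isSubLmodule of vertex_space by <:].

Definition l1_norm (x : vertex_space) : R := \sum_(v \in [set: V]) `|x v|.

Lemma l1_norm_widen (x : vertex_space) (s : {fset V}) :
  (forall v, x v != 0 -> v \in s) -> l1_norm x = \sum_(v <- s) `|x v|.
Proof.
move=> xs; rewrite /l1_norm fsbig_supp; apply: fsbig_fwiden => //.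
  by move=> v [_ /eqP]; rewrite normr_eq0 => /xs.
move=> v [_ /= vN]; apply/eqP/negPn/negP => v0; apply: vN.
by split=> //; exact/eqP.
Qed.

Let l1_normD x y : l1_norm (x + y) <= l1_norm x + l1_norm y.
Proof.
have [fx fy] := (coordP x, coordP y); rewrite !inE/= in fx fy.
pose s := (fset_set [set v | x v != 0%R] `|` fset_set [set v | y v != 0%R])%fset.
have sx v : x v != 0 -> v \in s by move=> xv; rewrite in_fsetU in_fset_set ?mem_set.
have sy v : y v != 0 -> v \in s by move=> yv; rewrite in_fsetU orbC in_fset_set ?mem_set.
rewrite !(@l1_norm_widen _ s)//; first by rewrite -big_split ler_sum// => v _; exact: ler_normD.
move=> v; apply: contraNT => vs.
suff [x0 y0] : x v = 0 /\ y v = 0 by have -> : (x + y) v = x v + y v by []; rewrite x0 y0 addr0.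
by split; apply/eqP; apply: contraNT vs => ?; [exact: sx|exact: sy].
Qed.

Let l1_normZ (a : R) x : l1_norm (a *: x) = `|a| * l1_norm x.
Proof.
have := coordP x; rewrite !inE/= => fx.
pose s := fset_set [set v | x v != 0%R].
have sx v : x v != 0 -> v \in s by move=> xv; rewrite in_fset_set ?mem_set.
rewrite !(@l1_norm_widen _ s)//; first by rewrite mulr_sumr; apply: eq_bigr => v _; exact: normrM.
move=> v axv; apply: sx; apply: contraNneq axv => x0.
by have -> : (a *: x) v = a * x v by []; rewrite x0 mulr0.
Qed.

Let l1_norm_eq0 x : l1_norm x = 0 -> x = 0.
Proof.
have := coordP x; rewrite !inE/= => fx.
pose s := fset_set [set v | x v != 0%R].
have sx v : x v != 0 -> v \in s by move=> xv; rewrite in_fset_set ?mem_set.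
rewrite (@l1_norm_widen _ s)// => /eqP; rewrite psumr_eq0// => /allP x0.
apply/val_inj/funext => v; apply/eqP/negPn/negP => /[dup] /sx vs.
by have := x0 _ vs; rewrite normr_eq0 /= => ->.
Qed.

HB.instance Definition _ :=
  Lmodule_isNormed.Build R vertex_space l1_normD l1_normZ l1_norm_eq0.

Fact vertex_subproof (v : V) :
  (fun w => (w == v)%:R : R) \in finitely_supported.
Proof.
rewrite inE/=; apply: sub_finite_set (finite_set1 v) => w /=.
by case: (eqVneq w v) => // _; rewrite eqxx.
Qed.

Definition vertex (v : V) : vertex_space := VertexSpace (vertex_subproof v).

Lemma coord_sum_vertex (s : {fset V}) (t : V -> R) (w : V) :
  (\sum_(v <- s) t v *: vertex v) w = if w \in s then t w else 0.
Proof.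
have -> : (\sum_(v <- s) t v *: vertex v) w = \sum_(v <- s) t v * (w == v)%:R.
  have -> : forall r : seq V,
      coord (\sum_(v <- r) t v *: vertex v) = \sum_(v <- r) coord (t v *: vertex v).
    by move=> r; elim/big_ind2 : _ => // ? ? ? ? <- <-.
  by rewrite fct_sumE.
case: ifPn => ws.
  rewrite (big_fsetD1 w)//= eqxx mulr1 big_seq big1 ?addr0// => v.
  by rewrite !inE eq_sym => /andP[/negPf->]; rewrite mulr0.
rewrite big_seq big1// => v vs; case: eqP => [wv|]; last by rewrite mulr0.
by rewrite wv vs in ws.
Qed.

Lemma vertex_independent (s : {fset V}) (t : V -> R) :
  \sum_(v <- s) t v *: vertex v = 0 -> forall v, v \in s -> t v = 0.
Proof.
by move=> st v vs; have := coord_sum_vertex s t v; rewrite st vs => <-.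
Qed.

End VertexSpace.

Section GeometricRealisation.
Variables (R : realType) (V : choiceType).
Local Notation E := (vertex_space R V).

Definition affine_hull (s : {fset V}) : set E :=
  [set x | exists2 t : V -> R,
    \sum_(v <- s) t v = 1 & x = \sum_(v <- s) t v *: vertex R v].

Definition convex_hull (s : {fset V}) : set E :=
  [set x | exists t : V -> R,
    [/\ forall v, v \in s -> 0 <= t v, \sum_(v <- s) t v = 1
      & x = \sum_(v <- s) t v *: vertex R v]].

(* Relative interior of the convex hull: its interior in the affine hull. *)
Definition open_simplex (s : {fset V}) : set E :=
  [set x | affine_hull s x /\
    \forall y \near x, affine_hull s y -> convex_hull s y].

Variable S : complex V.

Definition polyhedron : set E := \bigcup_(s in simplices S) convex_hull s.

(* A copy of the subtype of E, to receive the Whitehead topology instead of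
   the subspace topology. *)
Definition realisation : Type := set_type polyhedron.

HB.instance Definition _ := Choice.on realisation.

Definition realisation_val (p : realisation) : E := set_val p.

Definition whitehead_open (U : set realisation) :=
  forall s, simplices S s ->
    open (realisation_val @` U `&` convex_hull s : set (subspace (convex_hull s))).

Fact whitehead_openT : whitehead_open setT.
Proof.
move=> s Ss; rewrite (_ : _ `&` _ = setT `&` convex_hull s).
  by rewrite open_subspaceIT; exact: openT.
apply/seteqP; split=> [x []//|x [_ sx]]; split=> //.
have px : x \in polyhedron by rewrite inE; exists s.
by exists (SigSub px).
Qed.

Fact whitehead_openI : setI_closed whitehead_open.
Proof.
move=> A B oA oB s Ss; have := openI (oA s Ss) (oB s Ss).
congr open; apply/seteqP; split=> x.
  by move=> [[[p Ap <-] sp] [[q Bq /val_inj qp] _]]; subst q; split=> //; exists p.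
by move=> [[p [Ap Bp] <-] sp]; split; split=> //; exists p.
Qed.

Fact whitehead_open_bigU (I : Type) (f : I -> set realisation) :
  (forall i, whitehead_open (f i)) -> whitehead_open (\bigcup_i f i).
Proof.
move=> fo s Ss; rewrite image_bigcup setI_bigcupl.
by apply: bigcup_open => i _; exact: fo.
Qed.

HB.instance Definition _ := isOpenTopological.Build realisation
  whitehead_openT whitehead_openI whitehead_open_bigU.

Definition open_star (v : V) : set realisation :=
  [set p | exists s, [/\ simplices S s, v \in s & open_simplex s (realisation_val p)]].

End GeometricRealisation.

Section Nerve.
Variables (X : topologicalType) (U : nat -> set (set X)).
Local Notation index := (set X * nat)%type.

Definition ker (s : {fset index}) : set X := \bigcap_(i in [set` s]) i.1.

Definition nerve_simplices : set {fset index} :=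
  [set s | [/\ s != fset0, forall i, i \in s -> U i.2 i.1 & ker s !=set0]].

Fact nerve_neq0 s : nerve_simplices s -> s != fset0.
Proof. by case. Qed.

Fact nerve_face s t : nerve_simplices s ->
  (t `<=` s)%fset -> t != fset0 -> nerve_simplices t.
Proof.
move=> [s0 Us [x kx]] /fsubsetP ts t0; split=> // [i /ts /Us//|].
by exists x => i /ts; exact: kx.
Qed.

Definition nerve := Complex nerve_neq0 nerve_face.

Definition Delta_simplices : set {fset index} :=
  [set s | simplices nerve s /\
    forall i j, i \in s -> j \in s -> i.2 = j.2 -> i = j].

Fact Delta_neq0 s : Delta_simplices s -> s != fset0.
Proof. by case=> /nerve_neq0. Qed.

Fact Delta_face s t : Delta_simplices s ->
  (t `<=` s)%fset -> t != fset0 -> Delta_simplices t.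
Proof.
move=> [Ns sU] ts t0; split; first exact: nerve_face ts t0.
by move=> i j /(fsubsetP ts) si /(fsubsetP ts) sj; exact: sU.
Qed.

Definition Delta := Complex Delta_neq0 Delta_face.

Definition canonical_map (R : realType) (f : X -> realisation R Delta) :=
  continuous f /\
  forall n A, U n A -> f @^-1` open_star (A, n) `<=` A.

End Nerve.

(* Main.v *)
(* A canonical map f gives the families V_n of preimages of the open stars of
   the vertices (U, n); they are disjoint because a simplex of Delta has at most
   one vertex at each level n. Conversely a canonical map is a selection for the
   union of the mappings phi_n, where phi_n x consists of the points of |Delta|
   whose carrier only has vertices (U, k) with x in U and k <= n: the compact
   sets of |Delta| have finitely many carriers, and phi_n x is contracted in
   phi_(n+1) x by coning from a vertex (U, n+1) with x in U.

   From a C-space to selections: choose locally finite covers D_0, D_1, ... and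
   a centre c(A) for each A in D_n. Above the sets A_1, ..., A_m of distinct
   covers whose closures contain x, asphericity yields a map h_x of the cube
   [-1, 1]^m into phi_m x, by induction on m: on a face t_i = -1 the vertex A_i
   is forgotten, and on a face t_i = 1 the map is h_(c(A_i)) on the coordinates
   of the covers preceding that of A_i. As phi_n is lower locally constant, the
   finitely many maps h_x over D_0, ..., D_(n-1) still have suitable values at
   the points near x, and D_n is chosen to refine these neighbourhoods. Finally
   the C-property is applied once to the whole sequence D_n: it gives open
   families V_n, whose unions O_n cover X and on which the choice of A in D_n is
   locally constant. With functions t_n equal to -1 near the complement of O_n
   and such that the interiors of the sets {t_n = 1} cover X, the selection at a
   point x with t_k x = 1 is h_(c(A_k)) (t_0 x, ..., t_(k-1) x), and this value
   does not depend on k. *)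
Require Import Defs.
From HB Require Import structures.
From mathcomp Require Import all_boot all_order all_algebra finmap.
From mathcomp Require Import all_classical all_reals all_analysis.

Set Implicit Arguments.
Unset Strict Implicit.
Unset Printing Implicit Defensive.

Import Order.TTheory GRing.Theory Num.Theory numFieldNormedType.Exports.
Local Open Scope classical_set_scope.
Local Open Scope ring_scope.

(** * Finite intersections of neighbourhoods and relative continuity *)

Lemma near_finite_set (T : Type) (F : set_system T) (I : choiceType) (S : set I)
    (P : I -> T -> Prop) : Filter F -> finite_set S ->
  (forall i, S i -> \forall x \near F, P i x) ->
  \forall x \near F, forall i, S i -> P i x.
Proof.
move=> FF finS FP.
have : F (\bigcap_(i in [set` fset_set S]) P i).
  by apply: filter_bigI => i; rewrite in_fset_set// inE => /FP.
by apply: filterS => x Px i Si; apply: Px; rewrite /= in_fset_set// inE.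
Qed.

Lemma open_finite_bigcap (T : topologicalType) (I : choiceType) (S : set I)
    (F : I -> set T) : finite_set S -> (forall i, S i -> open (F i)) ->
  open (\bigcap_(i in S) F i).
Proof.
move=> finS oF; rewrite openE => x Fx.
apply: (near_finite_set _ finS) => i Si.
by apply: open_nbhs_nbhs; split; [exact: oF|exact: Fx].
Qed.

Lemma within_continuousP (T U : topologicalType) (A : set T) (f : T -> U) :
  {within A, continuous f} <->
  forall x, A x -> forall N, nbhs (f x) N -> \forall z \near x, A z -> N (f z).
Proof. by rewrite subspace_continuousP. Qed.

(** * Separation, shrinking and subordinate functions on paracompact spaces *)

Section Paracompact.
Variable X : topologicalType.

(** Only the finitely many members that meet a neighbourhood [N] of [x] matter, and the complement
    of each closure that misses [x] is a neighbourhood of [x]. *)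
Lemma locally_finite_closure_near (D : set (set X)) : locally_finite D ->
  forall x, \forall x' \near x, forall A, D A -> closure A x' -> closure A x.
Proof.
move=> lfD x; have [N Nx finN] := lfD x.
have : \forall x' \near x,
    forall A, [set A | D A /\ A `&` N !=set0] A -> closure A x' -> closure A x.
  apply: near_finite_set finN _ => A _.
  have [clA|nclA] := pselect (closure A x); first exact: filterE.
  have : nbhs x (~` closure A).
    by apply: open_nbhs_nbhs; split=> //; exact/closed_openC/closed_closure.
  by apply: filterS => x' + /[dup].
apply: filterS2 (nbhs_interior Nx) => x' Nx' h A DA clA.
by apply: (h A) => //; split=> //; exact: clA.
Qed.

Lemma locally_finite_closure_finite (D : set (set X)) : locally_finite D ->
  forall x, finite_set [set A | D A /\ closure A x].
Proof.
move=> lfD x; have [N Nx finN] := lfD x.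
by apply: sub_finite_set finN => A [DA /(_ _ Nx)].
Qed.

Lemma locally_finite_closure_bigcup (D : set (set X)) : locally_finite D ->
  forall E, E `<=` D ->
  closure (\bigcup_(A in E) A) `<=` \bigcup_(A in E) closure A.
Proof.
move=> lfD E ED x clx; apply/not_notP => nEx.
have /clx[x' [[A EA Ax']]] := locally_finite_closure_near lfD x.
move=> /(_ A (ED _ EA) (subset_closure Ax')) clA.
by apply: nEx; exists A.
Qed.

Hypothesis pX : paracompact X.

(* Used with B a point, where Hausdorff separation gives the hypothesis, and
   then with B closed, where regularity does. *)
Lemma paracompact_separation (B W : set X) : open W -> B `<=` W ->
    (forall y, ~ W y -> exists O, [/\ open O, O y & B `&` closure O = set0]) ->
  exists Q, [/\ open Q, B `<=` Q & closure Q `<=` W].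
Proof.
move=> oW BW sep.
pose C := [set O | open O /\ (O = W \/ B `&` closure O = set0)].
have [D [[oD cD] refD lfD]] : exists D,
    [/\ open_cover D, refines D C & locally_finite D].
  apply: pX; split=> [A []// |]; apply/seteqP; split=> // y _.
  have [Wy|/sep[ O [oO Oy BO]]] := pselect (W y).
    by exists W => //; split=> //; left.
  by exists O => //; split=> //; right.
pose E := [set A | D A /\ B `&` closure A = set0].
pose G := \bigcup_(A in E) A.
have oG : open G by apply: bigcup_open => A [/oD].
(* By local finiteness [closure G] lies in a union of closures that miss [B]. A point outside [G]
   lies in a member of [D] contained in [W], and the complement of [G] is closed. *)
exists (~` closure G); split; first exact/closed_openC/closed_closure.
- move=> x Bx /(locally_finite_closure_bigcup lfD (E := E)) [|A [_]].
    by move=> A [].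
  by move=> /seteqP[+ _] => /(_ x) BA clAx; apply: BA.
- have : ~` closure G `<=` ~` G by apply: subsetC; exact: subset_closure.
  move=> /closureS; have /closure_id <- := open_closedC oG => h x /h Gx.
  apply/not_notP => Wx; apply: Gx.
  have := I : [set: X] x; rewrite -cD => -[A DA Ax]; exists A => //.
  split=> //; have [ O [oO [OW|BO]] AO] := refD _ DA.
    by exfalso; apply: Wx; rewrite -OW; exact: AO.
  apply/seteqP; split=> // z [Bz Az]; rewrite -BO; split=> //.
  exact: (closureS AO).
Qed.

Hypothesis hX : hausdorff_space X.

Lemma paracompact_regular (x : X) (W : set X) : nbhs x W ->
  exists Q, [/\ open Q, Q x & closure Q `<=` W].
Proof.
rewrite nbhsE => -[W' [oW' W'x] W'W].
have [||Q [oQ xQ QW]] := @paracompact_separation [set x] W' oW'.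
- by move=> _ ->.
- move=> y W'y; have xy : x != y by apply: contra_notN W'y => /eqP <-.
  move: hX; rewrite open_hausdorff => /(_ _ _ xy)[[A O]]/=.
  rewrite !inE => -[Ax Oy] [oA oO AO]; exists O; split=> //.
  apply/seteqP; split=> // _ [-> /(_ A)].
  rewrite setIC AO => -[|? []//]; exact: open_nbhs_nbhs.
- exists Q; split=> //; first exact: xQ.
  by apply: subset_trans QW _.
Qed.

Lemma paracompact_normal (B W : set X) : closed B -> open W -> B `<=` W ->
  exists Q, [/\ open Q, B `<=` Q & closure Q `<=` W].
Proof.
move=> cB oW BW; apply: paracompact_separation => // y Wy.
have [|Q [oQ Qy QB]] := @paracompact_regular y (~` B).
  by apply: open_nbhs_nbhs; split; [exact: closed_openC|move/BW].
exists Q; split=> //; apply/seteqP; split=> // z [Bz /QB]; exact.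
Qed.

Lemma paracompact_normal_space : normal_space X.
Proof.
move=> B cB N /set_nbhsP[W [oW BW WN]].
have [Q [oQ BQ QW]] := paracompact_normal cB oW BW.
exists Q; first by apply/set_nbhsP; exists Q; split.
exact: subset_trans WN.
Qed.

(** Each point has, by regularity, an open neighbourhood whose closure lies in some [W i]; a locally
    finite refinement of these open sets inherits the property. The index [i0] is the value of [c]
    off [D]. *)
Lemma locally_finite_shrinking (I : Type) (i0 : I)
    (W : I -> set X) :
    (forall x : X, exists i, nbhs x (W i)) ->
  exists D (c : set X -> I), [/\ open_cover D, locally_finite D
    & forall A, D A -> closure A `<=` W (c A)].
Proof.
move=> Wx; pose C := [set Q | open Q /\ exists i, closure Q `<=` W i].
have [D [[oD cD] refD lfD]] : exists D,
    [/\ open_cover D, refines D C & locally_finite D].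
  apply: pX; split=> [A []// |]; apply/seteqP; split=> // y _.
  have [i /paracompact_regular[Q [oQ Qy QW]]] := Wx y.
  by exists Q => //; split=> //; exists i.
have Di A : exists i, D A -> closure A `<=` W i.
  have [DA|nDA] := pselect (D A).
    by have [Q [_ [i Qi]] AQ] := refD _ DA; exists i => _; exact: subset_trans (closureS AQ) Qi.
  by exists i0.
have [c cP] := choice Di.
by exists D, c; split=> //; split.
Qed.

Lemma countable_shrinking (O : nat -> set X) : (forall n, open (O n)) ->
    \bigcup_n O n = setT ->
  exists P : nat -> set X, [/\ forall n, open (P n), \bigcup_n P n = setT
    & forall n, closure (P n) `<=` O n].
Proof.
move=> oO cO; have [|D [c [[oD cD] lfD Dc]]] := @locally_finite_shrinking nat 0%N O.
  move=> x; have := I : [set: X] x; rewrite -cO => -[n _ Onx]; exists n.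
  by apply: open_nbhs_nbhs; split.
(* The members of [D] are grouped by their index; local finiteness keeps the closure of each group
   inside [O n]. *)
exists (fun n => \bigcup_(A in [set A | D A /\ c A = n]) A); split=> [n||n].
- by apply: bigcup_open => A [/oD].
- apply/seteqP; split=> // x _; have := I : [set: X] x; rewrite -cD => -[A DA Ax].
  by exists (c A) => //; exists A.
- move=> x /(locally_finite_closure_bigcup lfD)[|A [DA <-]]; first by move=> A [].
  exact: Dc.
Qed.

Lemma subordinate_functions (R : realType) (O : nat -> set X) :
    (forall n, open (O n)) -> \bigcup_n O n = setT ->
  exists t : nat -> X -> R, [/\ forall n, continuous (t n),
    forall n x, `|t n x| <= 1,
    forall x : X, exists n, \forall x' \near x, t n x' = 1
    & forall n x, ~ O n x -> \forall x' \near x, t n x' = -1].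
Proof.
move=> oO cO; have [P [oP cP PO]] := countable_shrinking oO cO.
have tP n : exists t : X -> R, [/\ continuous t, forall x, `|t x| <= 1,
    P n `<=` [set x | t x = 1] &
    forall x, ~ O n x -> \forall x' \near x, t x' = -1].
  (* The value -5 off [O n] leaves room below -1: near a point outside [O n] the function stays
     under -1, so its truncation at -1 is constant there. *)
  have [||f [cf fO fP f01]] := @urysohn_ext_itv X R paracompact_normal_space
      (~` O n) (closure (P n)) (-5%:R) 1 (open_closedC (oO n)) (@closed_closure _ _).
  - by apply/seteqP; split=> // x [nOx /PO].
  - by rewrite (lt_trans _ (@ltr01 R))// oppr_lt0 ltr0n.
  exists (fun x => Num.max (-1) (f x)); split.
  - move=> x; apply: (@continuous_max _ _ (fun=> -1) f); last exact: cf.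
    exact: cst_continuous.
  - move=> x; rewrite ler_norml le_max lexx/= ge_max.
    rewrite (le_trans _ (@ler01 R)) ?lerN10//=.
    have /f01 : range f (f x) by exists x.
    by rewrite /= in_itv/= => /andP[].
  - move=> x Px /=; rewrite (fP (f x)); last by exists x => //; exact: subset_closure.
    by rewrite /Order.max (lt_trans _ (@ltr01 R))// oppr_lt0 ltr01.
  - move=> x nOx; have fx : f x = -5%:R by apply: fO; exists x.
    have : \forall x' \near x, f x' < -1.
      apply: (cf x [set r | r < -1]); apply: open_nbhs_nbhs; split.
        exact: open_lt.
      by rewrite /= fx ltrN2 ltr1n.
    by apply: filterS => x' fx'; rewrite /Order.max ltNge (ltW fx').
have [t tE] := choice tP.
exists t; split=> [n|n x|x|n x]; try by have [] := tE n.
- have := I : [set: X] x; rewrite -cP => -[n _ Pnx]; exists n.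
  have [_ _ + _] := tE n => h; apply: filterS h _.
  by apply: open_nbhs_nbhs; split.
- by have [_ _ _] := tE n; exact.
Qed.
End Paracompact.

(** * Barycentric coordinates on simplices *)

Lemma cvg_sum_seq (R : realType) (T : Type) (F : set_system T) (I : Type)
    (r : seq I) (f : I -> T -> R) (a : I -> R) : Filter F ->
    (forall i, f i x @[x --> F] --> a i) ->
  \sum_(i <- r) f i x @[x --> F] --> \sum_(i <- r) a i.
Proof.
move=> FF fa; elim: r => [|i r IH].
  by under eq_fun do rewrite big_nil; rewrite big_nil; exact: cvg_cst.
under eq_fun do rewrite big_cons; rewrite big_cons.
by apply: (@cvgD _ R^o) => //; exact: fa.
Qed.

Section SimplexCoordinates.
Variables (R : realType) (V : choiceType).
Local Notation E := (vertex_space R V).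

(** For a point of the realisation, this is the vertex set of its carrier, the unique open simplex
    that contains it. *)
Definition supp (x : E) : {fset V} := fset_set [set v | x v != 0].

Lemma in_supp (x : E) v : (v \in supp x) = (x v != 0).
Proof.
have := coordP x; rewrite !inE/= => fx.
by rewrite in_fset_set //; apply/idP/idP; rewrite inE.
Qed.

Lemma coord_le_norm (x : E) v : `|x v| <= `|x|.
Proof.
have -> : `|x| = l1_norm x by [].
rewrite (@l1_norm_widen _ _ x (v |` supp x)%fset); last first.
  by move=> w xw; rewrite in_fset1U in_supp xw orbT.
rewrite (big_fsetD1 v)/= ?fset1U1 // lerDl sumr_ge0 // => w _.
Qed.

Lemma vertex_coord_continuous v : continuous (fun x : E => x v).
Proof.
move=> x; apply/(@cvgrPdist_lt _ R^o _ (nbhs (x : E))) => e e0; near=> y.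
apply: le_lt_trans (coord_le_norm (x - y) v) _.
by near: y; apply: cvgr_dist_lt.
Unshelve. all: by end_near. Qed.

Lemma affine_hullP (s : {fset V}) (x : E) : affine_hull s x <->
  (forall v, v \notin s -> x v = 0) /\ \sum_(v <- s) x v = 1.
Proof.
split=> [[t t1 ->]|[x0 x1]].
  split=> [v /negPf vs|]; first by rewrite coord_sum_vertex vs.
  by rewrite -t1 [LHS]big_seq [RHS]big_seq; apply: eq_bigr => v vs; rewrite coord_sum_vertex vs.
exists x => //; apply/val_inj/funext => v /=; rewrite coord_sum_vertex.
by case: ifPn => // /x0.
Qed.

Lemma convex_hullP (s : {fset V}) (x : E) : convex_hull s x <->
  affine_hull s x /\ forall v, 0 <= x v.
Proof.
split=> [[t [t0 t1 xE]]|[/affine_hullP[x0 x1] xge0]].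
  split; first by exists t.
  by move=> v; rewrite xE coord_sum_vertex; case: ifPn => // /t0.
exists x; split=> //; apply/val_inj/funext => v /=; rewrite coord_sum_vertex.
by case: ifPn => // /x0.
Qed.

Lemma convex_hullS (s t : {fset V}) (x : E) : convex_hull s x ->
  (supp x `<=` t)%fset -> convex_hull t x.
Proof.
move=> /convex_hullP[/affine_hullP[x0 x1] xge0] /fsubsetP xt.
apply/convex_hullP; split=> //; apply/affine_hullP; split=> [v|].
  by apply: contraNeq => xv; apply: xt; rewrite in_supp.
have sumE (r : {fset V}) : (supp x `<=` r)%fset ->
    \sum_(v <- r) x v = \sum_(v <- supp x) x v.
  move=> xr; apply/esym/big_fset_incl => // v _; rewrite in_supp.
  by move=> /negPn/eqP.
rewrite sumE; last exact/fsubsetP.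
rewrite -(sumE s) //; apply/fsubsetP => v; rewrite in_supp.
by apply: contraNT => /x0 ->.
Qed.

Lemma convex_hull_supp (s : {fset V}) (x : E) : convex_hull s x ->
  (supp x `<=` s)%fset.
Proof.
move=> /convex_hullP[/affine_hullP[x0 _] _]; apply/fsubsetP => v.
by rewrite in_supp; apply: contraNT => /x0 ->.
Qed.

Lemma convex_hull_supp_neq0 (s : {fset V}) (x : E) : convex_hull s x ->
  supp x != fset0.
Proof.
move=> sx; have /convex_hullP[/affine_hullP[_ x1] _] := convex_hullS sx (fsubset_refl _).
by apply: contra_eq_neq x1 => ->; rewrite big_seq_fset0 eq_sym oner_neq0.
Qed.

Lemma vertexE (v w : V) : vertex R v w = (w == v)%:R.
Proof. by []. Qed.

Lemma convex_hull_vertex (s : {fset V}) v : v \in s ->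
  convex_hull s (vertex R v).
Proof.
move=> vs; apply/convex_hullP; split; last by move=> w; rewrite vertexE ler0n.
apply/affine_hullP; split=> [w|].
  by rewrite vertexE; apply: contraNeq; rewrite pnatr_eq0 eqb0 negbK => /eqP ->.
rewrite (big_fsetD1 v) // vertexE eqxx big_seq big1 => [|w].
  exact: addr0.
by rewrite in_fsetD1 vertexE => /andP[/negPf ->].
Qed.

Lemma convex_hull_conv (s : {fset V}) (x y : E) (a : R) : 0 <= a <= 1 ->
  convex_hull s x -> convex_hull s y -> convex_hull s (a *: x + (1 - a) *: y).
Proof.
move=> /andP[a0 a1] /convex_hullP[/affine_hullP[x0 x1] xge0].
move=> /convex_hullP[/affine_hullP[y0 y1] yge0].
have zE v : (a *: x + (1 - a) *: y) v = a * x v + (1 - a) * y v by [].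
apply/convex_hullP; split; last first.
  by move=> v; rewrite zE addr_ge0 // mulr_ge0 // subr_ge0.
apply/affine_hullP; split=> [v vs|]; first by rewrite zE x0 // y0 // !mulr0 addr0.
under eq_bigr do rewrite zE.
by rewrite big_split/= -!mulr_sumr x1 y1 !mulr1 subrKC.
Qed.

(** For nonnegative coordinates the l1 norm is their sum. This gives the continuity of cones at
    their apex. *)
Lemma convex_hull_norm (s : {fset V}) (x : E) : convex_hull s x -> `|x| = 1.
Proof.
move=> /convex_hullP[/affine_hullP[x0 x1] xge0].
have -> : `|x| = l1_norm x by [].
rewrite (@l1_norm_widen _ _ x s); last by move=> v; apply: contra_neqT => /x0.
by rewrite -x1; apply: eq_bigr => v _; rewrite ger0_norm.
Qed.

Lemma convex_hull_closed (s : {fset V}) : closed (convex_hull s : set E).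
Proof.
have -> : convex_hull s =
    (\bigcap_(v in [set v | v \notin s]) [set x : E | x v = 0]) `&`
    [set x : E | \sum_(v <- s) x v = 1] `&` (\bigcap_v [set x : E | 0 <= x v]).
  apply/seteqP; split=> x.
    by move=> /convex_hullP[/affine_hullP[x0 x1] xge0]; split=> [|v _]; [split|exact: xge0].
  move=> [[x0 x1] xge0]; apply/convex_hullP; split; last by move=> v; exact: xge0.
  by apply/affine_hullP; split=> // v vs; exact: x0.
apply: closedI; first apply: closedI.
- apply: closed_bigI => v _.
  apply: (@preimage_closed _ _ (fun x : E => x v) [set 0]); last exact: closed_eq.
  by move=> x _; exact: vertex_coord_continuous.
- apply: (@preimage_closed _ _ (fun x : E => \sum_(v <- s) x v) [set 1]); last exact: closed_eq.
  move=> x _; apply: (@cvg_sum_seq _ _ (nbhs (x : E))) => v.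
  exact: (@vertex_coord_continuous v x).
- apply: closed_bigI => v _.
  apply: (@preimage_closed _ _ (fun x : E => x v) [set r | 0 <= r]).
    by move=> x _; exact: vertex_coord_continuous.
  exact: closed_ge.
Qed.

(** If all coordinates in [s] are positive, they remain so nearby, since [s] is finite. Conversely,
    at a point with a zero coordinate the affine hull leaves the simplex at once. *)
Lemma open_simplexP (s : {fset V}) (x : E) : open_simplex s x <->
  convex_hull s x /\ s = supp x.
Proof.
split=> [[ax nearx]|[cx sE]]; last first.
  move/convex_hullP: (cx) => [ax xge0]; split=> //.
  have : \forall y \near (x : E), forall v : V, v \in s -> 0 < (y : E) v.
    apply: (@near_finite_set _ (nbhs (x : E)) _ [set` s]
      (fun v (y : E) => 0 < y v)) => // v; rewrite /= sE in_supp => xv.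
    apply: (@vertex_coord_continuous v x [set r | 0 < r]).
    apply: open_nbhs_nbhs; split; first exact: open_gt.
    by rewrite /= lt_neqAle eq_sym xv xge0.
  apply: filterS => y ypos ay; apply/convex_hullP; split=> // v.
  have [vs|vs] := boolP (v \in s); first exact/ltW/ypos.
  by have /affine_hullP[-> ] := ay.
have cx : convex_hull s x by exact: nbhs_singleton nearx ax.
split=> //; apply/eqP; rewrite eqEfsubset (convex_hull_supp cx) andbT.
apply/fsubsetP => v vs; rewrite in_supp; apply/eqP => xv0.
(* Moving away from the vertex v stays in the affine hull but leaves the
   simplex. *)
pose y (e : R) : E := x + e *: (x - vertex R v).
have yE e w : y e w = x w + e * (x w - vertex R v w) by [].
have : y e @[e --> 0^'+] --> y 0.
  apply: cvg_at_right_filter; apply: cvgD; first exact: cvg_cst.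
  apply: cvgZr_tmp; exact: cvg_id.
have -> : y 0 = x by rewrite /y scale0r addr0.
move=> /(_ _ nearx) /= near0.
suff : \forall e \near (0 : R)^'+, False by move=> /filter_ex[].
near=> e; have e0 : 0 < e by [].
have /convex_hullP[_ /(_ v)] : convex_hull s (y e).
  have ae : affine_hull s (y e).
    move/affine_hullP: ax => [x0 x1]; apply/affine_hullP; split=> [w ws|].
      by rewrite yE vertexE x0 // (eq_sym w) (negPf (memPn ws _ vs)) subrr mulr0 addr0.
    under eq_bigr do rewrite yE.
    rewrite big_split/= -mulr_sumr x1 big_split/= x1 sumrN.
    have /convex_hullP[/affine_hullP[_ ->] _] := convex_hull_vertex vs.
    by rewrite subrr mulr0 addr0.
  by move: ae; near: e; exact: near0.
rewrite yE xv0 vertexE eqxx add0r sub0r mulrN1 oppr_ge0.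
by rewrite leNgt e0.
Unshelve. all: by end_near. Qed.
End SimplexCoordinates.

(** * The Whitehead topology *)

Section Realisation.
Variables (R : realType) (V : choiceType) (S : complex V).
Local Notation E := (vertex_space R V).
Local Notation val := (@realisation_val R V S).

Lemma realisation_openE (U : set (realisation R S)) :
  open U = whitehead_open U.
Proof. by []. Qed.

Lemma realisation_val_inj : injective val.
Proof. exact: val_inj. Qed.

Lemma realisation_hull (p : realisation R S) :
  simplices S (supp (val p)) /\ convex_hull (supp (val p)) (val p).
Proof.
have [s Ss sp] : @polyhedron R V S (val p) by exact: set_mem (valP p).
split; last exact: convex_hullS sp (fsubset_refl _).
exact: simplex_face Ss (convex_hull_supp sp) (convex_hull_supp_neq0 sp).
Qed.

Lemma realisation_exists (s : {fset V}) (x : E) : simplices S s ->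
  convex_hull s x -> exists p, val p = x.
Proof.
move=> Ss sx; have px : x \in @polyhedron R V S by rewrite inE; exists s.
by exists (SigSub px).
Qed.

Lemma realisation_val_continuous : continuous (val : _ -> E).
Proof.
apply/continuousP => U oU; rewrite realisation_openE => s Ss.
have -> : val @` (val @^-1` U) `&` convex_hull s = U `&` convex_hull s.
  apply/seteqP; split=> [x [[p Up <-] //]|x [Ux sx]]; split=> //.
  by have [p px] := realisation_exists Ss sx; exists p; rewrite ?px //= px.
by rewrite open_subspaceIT; exact: open_subspaceW.
Qed.

Lemma open_starP v (p : realisation R S) : open_star v p <-> val p v != 0.
Proof.
have [Sp hp] := realisation_hull p.
split=> [[s [Ss vs /open_simplexP[_ sE]]]|pv]; first by rewrite -in_supp -sE.
by exists (supp (val p)); split=> //; [rewrite in_supp|exact/open_simplexP].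
Qed.

Lemma open_star_open v : open (@open_star R V S v).
Proof.
have -> : @open_star R V S v = (fun p => val p v) @^-1` [set r | r != 0].
  by apply/seteqP; split=> p /open_starP.
apply: open_comp; last exact: open_neq.
move=> p _; apply: (@continuous_comp _ _ _ val (fun x : E => x v)).
  exact: realisation_val_continuous.
exact: vertex_coord_continuous.
Qed.

Lemma realisation_hausdorff : hausdorff_space (realisation R S).
Proof.
move=> p q pq; apply: realisation_val_inj.
apply: (@norm_hausdorff R E) => A B Ap Bq.
have [r [Ar Br]] := pq _ _ (realisation_val_continuous Ap) (realisation_val_continuous Bq).
by exists (val r).
Qed.

(** Otherwise one point of [K] for each of its infinitely many carriers would form an infinite
    closed discrete subset [P] of [K]. *)
Lemma compact_finite_supp (K : set (realisation R S)) : compact K ->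
  finite_set [set supp (val p) | p in K].
Proof.
move=> cK; apply/not_notP => infK.
pose C := [set supp (val p) | p in K].
have [rep repP] : exists rep : {fset V} -> realisation R S,
    forall c, C c -> K (rep c) /\ supp (val (rep c)) = c.
  have [p0 _] : exists p, K p.
    apply/not_notP => K0; apply: infK.
    apply: sub_finite_set (finite_set0 {fset V}) => _ [p Kp _] /=.
    by apply: K0; exists p.
  have Crep c : exists p, C c -> K p /\ supp (val p) = c.
    have [[p Kp pc]|] := pselect (C c); first by exists p.
    by exists p0.
  by have [rep repP] := choice Crep; exists rep.
pose P := rep @` C.
have infP : ~ finite_set P.
  move=> /(finite_image (fun p => supp (val p))) fP; apply: infK.
  apply: sub_finite_set fP => c Cc; exists (rep c); first by exists c.
  by have [] := repP c Cc.
(* A simplex has finitely many faces and [P] has one point for each carrier, so [B] meets each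
   simplex in a finite set. *)
have closedP B : B `<=` P -> closed B.
  move=> BP; rewrite -openC realisation_openE => s Ss.
  have fB : finite_set (val @` B `&` convex_hull s).
    apply: (@sub_finite_set _ _ ((fun c => val (rep c)) @` [set` fpowerset s])).
      move=> _ [[_ /[dup] /BP[c Cc <-] _ <-] sx]; exists c => //=.
      rewrite fpowersetE; have [_ <-] := repP c Cc.
      exact: convex_hull_supp sx.
    by apply: finite_image; exact: finite_fset.
  have -> : val @` (~` B) `&` convex_hull s =
      ~` (val @` B `&` convex_hull s) `&` convex_hull s.
    apply/seteqP; split=> x [].
      move=> [p nBp <-] sp; split=> // -[[q Bq /realisation_val_inj qp] _].
      by rewrite qp in Bq.
    move=> nB sx; split=> //; have [p px] := realisation_exists Ss sx.
    by exists p => // Bp; apply: nB; split=> //; exists p.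
  rewrite open_subspaceIT; apply: open_subspaceW.
  apply: closed_openC; have /accessible_finite_set_closed := hausdorff_accessible (@norm_hausdorff R E).
  exact.
(* The cofinite filter on [P] cannot cluster at any [p]: the set [P] without [p] belongs to it, and
   its complement is a neighbourhood of [p]. *)
pose F := [set B | finite_set (P `\` B)].
have FF : ProperFilter F.
  split; first by rewrite /F /= setD0.
  split.
  - by rewrite /F /= setDT.
  - by move=> A B FA FB; rewrite /F /= setDIr finite_setU.
  - by move=> A B AB; apply: sub_finite_set; exact: setDS.
have [|p [Kp clp]] := cK F FF.
  apply: sub_finite_set (finite_set0 _) => q [[c Cc <-]].
  by have [+ _] := repP c Cc.
have [|| q [[Pq qp] nq]] := clp (P `\ p) (~` (P `\ p)).
- by apply: sub_finite_set (finite_set1 p) => q [Pq]; apply: contra_notP => qp; split.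
- apply: open_nbhs_nbhs; split; first by apply: closed_openC; apply: closedP => q [].
  by move=> [_]; exact.
- by apply: nq; split.
Qed.

(* On a finite subcomplex the Whitehead topology is the norm topology. *)
Lemma realisation_within_continuous (Z : topologicalType) (A : set Z)
    (h : Z -> realisation R S) (K : set {fset V}) :
    finite_set K -> K `<=` simplices S ->
    (forall z, A z -> exists2 s, K s & convex_hull s (val (h z))) ->
    {within A, continuous (fun z => val (h z) : E)} ->
  {within A, continuous h}.
Proof.
move=> finK KS AK /subspace_continuousP ch; apply/subspace_continuousP => z Az.
move=> N; rewrite nbhsE => -[U [oU Uz] UN].
(* If the image of [z] lies in the simplex [s], the trace of [U] on [s] is a relative neighbourhood
   of it; if not, the closed simplex is avoided near [z]. *)
have near_s s : K s ->
    \forall z' \near within A (nbhs z), convex_hull s (val (h z')) -> U (h z').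
  move=> Ks; have [sz|nsz] := pselect (convex_hull s (val (h z))).
    have [ O oO OE] := (open_subspaceP _ _).1 (oU s (KS s Ks)).
    have : \forall x \near val (h z), O x.
      apply: open_nbhs_nbhs; split=> //.
      have : (O `&` convex_hull s) (val (h z)).
        by rewrite OE; split=> //; split=> //; exists (h z).
      by case.
    move=> /(ch z Az); apply: (@filterS _ (within A (nbhs z))) => z' /= Oz' sz'.
    have : (O `&` convex_hull s) (val (h z')) by [].
    by rewrite OE => -[[[p Up /realisation_val_inj <-]]].
  have : \forall x \near val (h z), (~` convex_hull s) x.
    apply: open_nbhs_nbhs; split=> //.
    exact/closed_openC/convex_hull_closed.
  by move=> /(ch z Az); apply: (@filterS _ (within A (nbhs z))) => z' /=.
have := near_finite_set _ finK near_s.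
move=> /(_ _); apply: filterS2 (withinT A (nbhs_filter z)) => z' Az' Hz'.
have [s Ks sz'] := AK z' Az'.
exact/UN/(Hz' s Ks).
Qed.
End Realisation.

(** * The Euclidean norm and its spheres *)

Section EuclideanNorm.
Variables (R : realType) (k : nat).
Local Notation rV := 'rV[R]_k.+1.

Definition norm2 (w : rV) : R := Num.sqrt (\sum_i w 0 i ^+ 2).

Lemma sum_sqr_ge0 (w : rV) : 0 <= \sum_i w 0 i ^+ 2.
Proof. by apply: sumr_ge0 => i _; exact: sqr_ge0. Qed.

Lemma norm2_ge0 (w : rV) : 0 <= norm2 w.
Proof. exact: sqrtr_ge0. Qed.

Lemma sphereE (w : rV) : sphere w <-> norm2 w = 1.
Proof.
rewrite /sphere /norm2 /=; split=> [->|]; first exact: sqrtr1.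
by move=> w1; rewrite -(sqr_sqrtr (sum_sqr_ge0 w)) w1 expr1n.
Qed.

Lemma unit_ballE (w : rV) : unit_ball w <-> norm2 w <= 1.
Proof. by rewrite /unit_ball /norm2 /= -[1 in X in _ <-> X]sqrtr1 ler_sqrt. Qed.

Lemma norm2Z (a : R) (w : rV) : norm2 (a *: w) = `|a| * norm2 w.
Proof.
rewrite /norm2 -sqrtr_sqr -sqrtrM ?sqr_ge0 // mulr_sumr.
by congr Num.sqrt; apply: eq_bigr => i _; rewrite mxE exprMn.
Qed.

Lemma norm_le_norm2 (w : rV) : `|w| <= norm2 w.
Proof.
rewrite [leLHS]mx_normrE; apply: bigmax_le; first exact: norm2_ge0.
move=> [i j] _ /=; rewrite (ord1 i) -sqrtr_sqr ler_sqrt ?sum_sqr_ge0 //.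
rewrite (bigD1 j) //= lerDl; apply: sumr_ge0 => l _; exact: sqr_ge0.
Qed.

Lemma norm2_eq0 (w : rV) : norm2 w = 0 -> w = 0.
Proof.
by move=> w0; apply/eqP; rewrite -normr_le0 -w0 norm_le_norm2.
Qed.

Lemma norm2_0 : norm2 0 = 0.
Proof. by rewrite -(scale0r 0) norm2Z normr0 mul0r. Qed.

Lemma norm2_continuous : continuous norm2.
Proof.
move=> w; apply: (@continuous_comp _ _ _ (fun w : rV => \sum_i w 0 i ^+ 2) Num.sqrt).
  apply: (@cvg_sum_seq _ _ (nbhs (w : rV))) => i.
    apply: (@continuous_comp _ _ _ (fun w : rV => w 0 i) (fun r => r ^+ 2)).
    exact: coord_continuous.
  exact: exprn_continuous.
exact: sqrt_continuous.
Qed.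

Lemma sphere_compact : compact (@sphere R k).
Proof.
apply: bounded_closed_compact.
  exists 1; split; first exact: num_real.
  move=> M M1 w /sphereE w1; apply: le_trans (ltW M1).
  by rewrite -w1 norm_le_norm2.
have -> : @sphere R k = norm2 @^-1` [set 1] by apply/seteqP; split=> w /sphereE.
by apply: preimage_closed; [move=> w _; exact: norm2_continuous|exact: closed_eq].
Qed.

Lemma sphere_normalize (w : rV) : w != 0 -> sphere ((norm2 w)^-1 *: w).
Proof.
move=> w0; apply/sphereE; rewrite norm2Z normrV ?unitfE.
  rewrite ger0_norm ?norm2_ge0 // mulVf //.
  by apply: contra_neq w0; exact: norm2_eq0.
by apply: contra_neq w0; exact: norm2_eq0.
Qed.

Lemma sphere_neq0 (w : rV) : sphere w -> w != 0.
Proof.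
by move=> /sphereE; apply: contra_eq_neq => ->; rewrite norm2_0 eq_sym oner_neq0.
Qed.

Lemma sphere_nonempty : exists w : rV, sphere w.
Proof.
exists ((norm2 (const_mx 1))^-1 *: const_mx 1); apply: sphere_normalize.
by apply/eqP => /rowP/(_ 0)/eqP; rewrite !mxE oner_eq0.
Qed.
End EuclideanNorm.

(** * Extension over balls by coning *)

Section Cone.
Variables (R : realType) (V : choiceType) (S : complex V) (v : V).
Variables B C : set (realisation R S).
Hypothesis Bv : forall p, B p -> simplices S (v |` supp (realisation_val p))%fset.
Hypothesis BC : forall p q, B p ->
  (supp (realisation_val q) `<=` v |` supp (realisation_val p))%fset -> C q.

(** The extension sends a point of radius r in direction u to r g(u) + (1 - r) v. As the sphere is
    compact, [g] meets finitely many carriers, so the cone lies in a finite subcomplex and its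
    continuity may be tested in the norm. *)
Lemma cone_sphere_extends k : sphere_extends R k B C.
Proof.
move=> g cg Bg; pose val := @realisation_val R V S.
pose n := fun w : 'rV[R]_k.+1 => (norm2 w)^-1 *: w.
pose hE (w : 'rV[R]_k.+1) : vertex_space R V :=
  norm2 w *: val (g (n w)) + (1 - norm2 w) *: vertex R v.
have [e0 e0S] := sphere_nonempty R k.
(* The centre has no direction; the arbitrary [e0] only provides a simplex that contains the
   apex. *)
pose base (w : 'rV[R]_k.+1) := g (if w == 0 then e0 else n w).
have Bbase w : B (base w).
  rewrite /base; case: ifPn => [_|w0]; first exact: Bg.
  exact/Bg/sphere_normalize.
have hull w : unit_ball w ->
    convex_hull (v |` supp (val (base w)))%fset (hE w).
  move=> /unit_ballE w1; rewrite /hE /base; case: eqP => [->|_].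
    rewrite norm2_0 scale0r add0r subr0 scale1r.
    by apply: convex_hull_vertex; exact: fset1U1.
  apply: convex_hull_conv; first by rewrite norm2_ge0.
    have [_ /convex_hullS] := realisation_hull (g (n w)); apply.
    exact: fsubsetU1.
  by apply: convex_hull_vertex; exact: fset1U1.
have hex w : exists p : realisation R S, unit_ball w -> val p = hE w.
  have [bw|nbw] := pselect (unit_ball w); last by exists (g w).
  by have [p] := realisation_exists (Bv (Bbase w)) (hull w bw); exists p.
have [h hP] := choice hex.
exists h; split.
- apply: (@realisation_within_continuous _ _ _ _ _ _
    [set (v |` supp (val p))%fset | p in g @` @sphere R k]).
  + rewrite (_ : [set _ | p in _] = (fun s => v |` s)%fset @`
        [set supp (val p) | p in g @` @sphere R k]).
      apply/finite_image/compact_finite_supp/continuous_compact => //.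
      exact: sphere_compact.
    by rewrite -image_comp.
  + by move=> _ [_ [w Sw <-] <-]; exact/Bv/Bg.
  + move=> w bw; exists (v |` supp (val (base w)))%fset.
      exists (base w) => //; rewrite /base; case: ifPn => [_|w0]; first by exists e0.
      by exists (n w) => //; exact: sphere_normalize.
    by rewrite -/val hP //; exact: hull.
  + apply: (@subspace_eq_continuous _ _ _ hE).
      by move=> w; rewrite inE => /hP.
    apply/subspace_continuousP => w bw.
    have cvg2 : norm2 w' @[w' --> within (@unit_ball R k) (nbhs w)] --> norm2 w.
      by apply: cvg_within_filter; exact: norm2_continuous.
    rewrite /hE; apply: cvgD; last first.
      by apply: cvgZr_tmp; apply: cvgB => //; exact: cvg_cst.
    have [w0|w0] := eqVneq w 0.
      (* At the centre [n] need not be continuous, but the first term of [hE] has norm [norm2 w],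
         because points of simplices have norm 1. *)
      rewrite w0 norm2_0 scale0r -w0; apply/norm_cvg0P.
      rewrite -(norm2_0 R k) -w0 (_ : (fun _ => `|_|) = @norm2 R k) //.
      apply/funext => w'; rewrite normrZ ger0_norm ?norm2_ge0 //.
      by have [_ /convex_hull_norm ->] := realisation_hull (g (n w')); rewrite mulr1.
    apply: cvgZ => //.
    have cn : n w' @[w' --> within (@unit_ball R k) (nbhs w)] --> n w.
      apply: cvgZ; last by apply: cvg_within_filter; exact: cvg_id.
      by apply: cvgV => //; apply: contra_neq w0; exact: norm2_eq0.
    have gn : g (n w') @[w' --> within (@unit_ball R k) (nbhs w)] --> g (n w).
      move=> N /((within_continuousP _ _).1 cg _ (sphere_normalize w0)) /cn Ng.
      have neq0 : \forall w' \near within (@unit_ball R k) (nbhs w), w' != 0.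
        have : nbhs (norm2 w) [set r | r != 0].
          apply: open_nbhs_nbhs; split; first exact: open_neq.
          by apply: contra_neq w0; exact: norm2_eq0.
        move=> /cvg2; apply: (@filterS _ (within (@unit_ball R k) (nbhs w))).
        by move=> w' /=; apply: contra_neq => ->; exact: norm2_0.
      have : \forall w' \near within (@unit_ball R k) (nbhs w), N (g (n w')).
        apply: filterS2 neq0 Ng => w' w'0; apply; exact: sphere_normalize.
      by [].
    exact: (cvg_comp _ _ gn (@realisation_val_continuous _ _ _ _)).
- move=> w bw; apply: (BC (Bbase w)); rewrite -/val hP //.
  exact: convex_hull_supp (hull w bw).
- move=> w sw; apply: realisation_val_inj; rewrite -/val hP; last first.
    by apply/unit_ballE; move/sphereE: sw => ->.
  rewrite /hE /n; move/sphereE: sw => ->.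
  by rewrite invr1 !scale1r subrr scale0r addr0.
Qed.
End Cone.

(** * From selections to canonical maps, and from canonical maps to C-spaces *)

Section CanonicalMaps.
Variables (R : realType) (X : topologicalType).

Lemma canonical_C_space : (forall U : nat -> set (set X),
    (forall n, open_cover (U n)) ->
    exists f : X -> realisation R (Delta U), canonical_map f) -> C_space X.
Proof.
move=> canon U covU; have [f [cf fU]] := canon U covU.
pose st A n := f @^-1` (@open_star R _ (Delta U) (A, n)).
exists (fun n => [set st A n | A in U n]); split.
- by move=> n _ [A UA <-]; apply: open_comp => //; exact: open_star_open.
- move=> n; apply/trivIsetP => _ _ [A UA <-] [A' UA' <-] /eqP neq.
  apply/seteqP; split=> // x [/open_starP xA /open_starP xA']; apply: neq.
  have [[_ inj] _] := realisation_hull (f x).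
  by rewrite -in_supp in xA; rewrite -in_supp in xA'; have [->] := inj _ _ xA xA' erefl.
- by move=> n _ [A UA <-]; exists A => //; exact: fU.
- apply/seteqP; split=> // x _; have [[[n0 Us _] _] _] := realisation_hull (f x).
  have /fset0Pn[[A n] iA] := n0; exists n => //; exists (st A n).
    by exists A => //; exact: Us iA.
  by apply/open_starP; rewrite -in_supp.
Qed.

Lemma selection_canonical : (forall Y : topologicalType, hausdorff_space Y ->
    forall phi : nat -> X -> set Y,
      (forall n, set_valued (phi n)) ->
      (forall n, lower_locally_constant (phi n)) ->
      aspherical R phi ->
    exists f : X -> Y,
      continuous f /\ selection (fun x => \bigcup_n phi n x) f) ->
  forall U : nat -> set (set X), (forall n, open_cover (U n)) ->
    exists f : X -> realisation R (Delta U), canonical_map f.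
Proof.
move=> sel U covU; pose val := @realisation_val R _ (Delta U).
pose phi n x := [set p : realisation R (Delta U) |
  forall i, i \in supp (val p) -> (i.2 <= n)%N /\ i.1 x].
have covx n x : exists2 A, U n A & A x.
  have [_ /seteqP[_ /(_ x I)[A UA Ax]]] := covU n; by exists A.
have [] := sel (realisation R (Delta U)) _ phi.
- exact: realisation_hausdorff.
- move=> n x; have [A UA Ax] := covx 0%N x.
  have sA : simplices (Delta U) [fset (A, 0%N)]%fset.
    split; last by move=> i j /fset1P -> /fset1P ->.
    split; first by apply/fset0Pn; exists (A, 0%N); exact: fset11.
      by move=> i /fset1P ->.
    by exists x => i /= /fset1P ->.
  have [p pE] := realisation_exists sA (convex_hull_vertex R (fset11 (A, 0%N))).
  exists p => i; rewrite in_supp /val pE vertexE pnatr_eq0 eqb0 negbK.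
  by move=> /eqP ->; split=> //; exact: leq0n.
- move=> n K cK.
  (* A point of [W i] allows the vertex [i] in carriers at level [n]. For the vertices that occur in
     [K], this set is either the open set [i.1] or empty. *)
  pose W (i : set X * nat) := [set x | (i.2 <= n)%N /\ i.1 x].
  have finK := compact_finite_supp cK.
  have -> : [set x | K `<=` phi n x] =
      \bigcap_(s in [set supp (val p) | p in K]) \bigcap_(i in [set` s]) W i.
    apply/seteqP; split=> x.
      by move=> Kx _ [p Kp <-] i /= ip; exact: (Kx p Kp i ip).
    by move=> Wx p Kp i ip; apply: (Wx (supp (val p))) => //; exists p.
  apply: open_finite_bigcap => // s [p Kp <-].
  apply: open_finite_bigcap => // i /= ip.
  have [[[_ Us _] _] _] := realisation_hull p.
  have oi : open i.1 by have [+ _] := covU i.2; apply; exact: Us.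
  have [in_|in_] := boolP (i.2 <= n)%N.
    by rewrite (_ : W i = i.1) //; apply/seteqP; split=> x => [[]|].
  rewrite (_ : W i = set0); first exact: open0.
  by apply/seteqP; split=> x // []; rewrite (negPf in_).
- move=> n x; have [A UA Ax] := covx n.+1 x.
  (* Carriers in [phi n x] only have levels up to [n], so adding a vertex of level [n.+1] keeps at
     most one vertex per level, and [x] remains in the kernel. *)
  apply: (@cone_sphere_extends _ _ _ (A, n.+1)).
  + move=> p phip; have [[[n0 Us _] inj] _] := realisation_hull p.
    split; first split.
    * by apply/fset0Pn; exists (A, n.+1); exact: fset1U1.
    * by move=> i /fset1UP[->|/Us].
    * by exists x => i /= /fset1UP[->|/phip[]].
    * move=> i j /fset1UP[->|ip] /fset1UP[->|jp] //= ij.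
      - by have [+ _] := phip _ jp; rewrite -ij ltnn.
      - by have [+ _] := phip _ ip; rewrite ij ltnn.
      - exact: inj.
  + move=> p q phip /fsubsetP qp i /qp /fset1UP[->|/phip[le_in Ai]]; first by [].
    by split=> //; exact: leqW.
- move=> f [cf fphi]; exists f; split=> // n A UA x /open_starP xA.
  by have [m _ /(_ (A, n))] := fphi x; rewrite in_supp => /(_ xA)[].
Qed.
End CanonicalMaps.

(** * Extension over cubes, and pasting *)

Section CubeExtension.
Variables (R : realType) (Y : topologicalType).

(** The norm of row vectors is the sup norm, so the cube is its unit ball; radial rescaling
    transfers the extension property from the Euclidean ball. *)
Lemma cube_extends k (S B : set Y) : sphere_extends R k S B ->
  forall g : 'rV[R]_k.+1 -> Y,
    {within [set t | `|t| = 1], continuous g} ->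
    (forall t, `|t| = 1 -> S (g t)) ->
  exists h : 'rV[R]_k.+1 -> Y,
    [/\ {within [set t | `|t| <= 1], continuous h},
        forall t, `|t| <= 1 -> B (h t)
      & forall t, `|t| = 1 -> h t = g t].
Proof.
move=> ext g cg Sg.
(* [p \o q] is the identity on the boundary of the cube, and this is all that
   is needed of a homeomorphism between the cube and the ball. *)
pose p (w : 'rV[R]_k.+1) := `|w|^-1 *: w.
pose q (t : 'rV[R]_k.+1) := (`|t| / norm2 t) *: t.
have n2N0 (w : 'rV[R]_k.+1) : w != 0 -> norm2 w != 0.
  by apply: contra_neq; exact: norm2_eq0.
have norm_p (w : 'rV[R]_k.+1) : w != 0 -> `|p w| = 1.
  by move=> w0; rewrite /p normrZ normfV normr_id mulVf // normr_eq0.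
have norm2_q (t : 'rV[R]_k.+1) : norm2 (q t) = `|t|.
  have [->|t0] := eqVneq t 0; first by rewrite /q scaler0 norm2_0 normr0.
  by rewrite norm2Z ger0_norm ?divr_ge0 ?norm2_ge0 // divfK // n2N0.
have cp (w : 'rV[R]_k.+1) : w != 0 -> p w' @[w' --> (w : 'rV[R]_k.+1)] --> p w.
  move=> w0; have F : Filter (nbhs (w : 'rV[R]_k.+1)) := nbhs_filter w.
  apply: (@cvgZ _ _ _ _ F); last exact: cvg_id.
  by apply: (@cvgV _ _ _ F); [rewrite normr_eq0|exact: norm_continuous].
have cq : continuous q.
  move=> t; have [->|t0] := eqVneq t 0.
    rewrite /continuous_at (_ : q 0 = 0); last by rewrite /q scaler0.
    apply/(@cvgrPdist_lt _ _ _ (nbhs (0 : 'rV[R]_k.+1))) => e e0.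
    apply: filterS (nbhs0_lt e0) => x; rewrite sub0r normrN; apply: le_lt_trans.
    by rewrite -(norm2_q x) norm_le_norm2.
  have F : Filter (nbhs (t : 'rV[R]_k.+1)) := nbhs_filter t.
  apply: (@cvgZ _ _ _ _ F); last exact: cvg_id.
  apply: (@cvgM _ _ _ F); first exact: norm_continuous.
  by apply: (@cvgV _ _ _ F); [exact: n2N0|exact: norm2_continuous].
have [| |H [cH BH HE]] := ext (g \o p).
- apply/within_continuousP => w Sw N; have w0 := sphere_neq0 Sw.
  move=> /((within_continuousP _ _).1 cg _ (norm_p w w0)) /(cp w w0) /=.
  by apply: (@filterS _ (nbhs w)) => w' Nw' Sw'; exact/Nw'/norm_p/sphere_neq0.
- by move=> w Sw; apply/Sg/norm_p; exact: sphere_neq0.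
have ball_q (t : 'rV[R]_k.+1) : `|t| <= 1 -> unit_ball (q t).
  by move=> t1; apply/unit_ballE; rewrite norm2_q.
exists (H \o q); split.
- apply/within_continuousP => t t1 N.
  move=> /((within_continuousP _ _).1 cH _ (ball_q t t1)) /cq.
  by apply: (@filterS _ (nbhs t)) => t' Nt' t'1; exact/Nt'/ball_q.
- by move=> t bt; apply: BH; apply/unit_ballE; rewrite norm2_q.
- move=> t t1; have t0 : t != 0 by rewrite -normr_eq0 t1 oner_neq0.
  rewrite /= HE; last by apply/sphereE; rewrite norm2_q.
  congr g; rewrite /p /q normrZ t1 mulr1 div1r normfV scalerA.
  by rewrite ger0_norm ?norm2_ge0 // invrK mulfV ?scale1r // n2N0.
Qed.
End CubeExtension.

(** The pasting lemma: the closed sets that miss [x] are avoided near [x]. *)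
Lemma within_continuous_bigcup (T U : topologicalType) (I : finType)
    (F : I -> set T) (f : T -> U) : (forall i, closed (F i)) ->
    (forall i, {within F i, continuous f}) ->
  {within \bigcup_i F i, continuous f}.
Proof.
move=> cF cf; apply/within_continuousP => x _ N Nfx.
have near_i i : [set: I] i -> \forall z \near x, F i z -> N (f z).
  move=> _; have [Fx|nFx] := pselect (F i x).
    exact: ((within_continuousP _ _).1 (cf i) x Fx N Nfx).
  have : \forall z \near x, (~` F i) z.
    by apply: open_nbhs_nbhs; split=> //; exact: closed_openC.
  by apply: filterS => z.
have := near_finite_set (nbhs_filter x) (@finite_finset _ [set: I]) near_i.
apply: (@filterS _ (nbhs x)).
by move=> z Nz [i _ Fz]; exact: Nz Fz.
Qed.

(** * Row vectors as lists of parameters *)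

Section RowSequences.
Variable R : realType.

Definition row_seq n (t : 'rV[R]_n) : seq R := [seq t 0 i | i <- enum 'I_n].
Definition seq_row n (r : seq R) : 'rV[R]_n := \row_i r`_i.

Lemma size_row_seq n (t : 'rV[R]_n) : size (row_seq t) = n.
Proof. by rewrite size_map size_enum_ord. Qed.

Lemma nth_row_seq n (t : 'rV[R]_n) (i : 'I_n) : (row_seq t)`_i = t 0 i.
Proof. by rewrite (nth_map i) ?size_enum_ord // nth_ord_enum. Qed.

Lemma row_seqK n (t : 'rV[R]_n) : seq_row n (row_seq t) = t.
Proof. by apply/rowP => i; rewrite mxE nth_row_seq. Qed.

Lemma seq_rowK n (r : seq R) : size r = n -> row_seq (seq_row n r) = r.
Proof.
move=> rn; apply: (@eq_from_nth _ 0) => [|i]; rewrite size_row_seq ?rn // => ni.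
by rewrite (nth_row_seq _ (Ordinal ni)) mxE.
Qed.

Lemma norm_row_le n (t : 'rV[R]_n.+1) (a : R) : 0 <= a ->
  `|t| <= a <-> forall i, `|t 0 i| <= a.
Proof.
move=> a0; rewrite [leLHS]mx_normrE; split.
  by move=> /bigmax_leP[_ ta] i; exact: (ta (0, i)).
by move=> ta; apply: bigmax_le => // -[i j] _ /=; rewrite (ord1 i).
Qed.

Lemma norm_row_lt1 n (t : 'rV[R]_n.+1) : (forall i, `|t 0 i| < 1) -> `|t| < 1.
Proof.
move=> t1; rewrite [ltLHS]mx_normrE; apply: bigmax_lt => // -[i j] _ /=.
by rewrite (ord1 i).
Qed.

End RowSequences.

(** * Construction of the cell maps *)

Section Cells.
Variables (R : realType) (X Y : topologicalType) (phi : nat -> X -> set Y).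
Hypothesis phi_aspherical : aspherical R phi.
Variable y0 : X -> Y.
Hypothesis phi_y0 : forall x, phi 0 x (y0 x).

(* A cell at x is a list of centres y_1, ..., y_m with parameters in
   [-1, 1]^m. On its boundary the cell map is prescribed: a coordinate -1
   deletes its vertex, and a coordinate 1 at y_i continues with the cell at y_i
   on the remaining centres y_(i+1), ..., y_m, forgetting x and the previous
   centres. Normalising lists first makes both rules hold by construction. *)
Definition cell_step (p : X * seq (X * R)) (q : X * R) : X * seq (X * R) :=
  if q.2 == 1 then (q.1, [::])
  else if q.2 == -1 then p else (p.1, rcons p.2 q).

Definition cell_normal x l := foldl cell_step (x, [::]) l.

Definition cell_filling x k (g h : 'rV[R]_k.+1 -> Y) :=
  [/\ {within [set t | `|t| <= 1], continuous h},
      forall t, `|t| <= 1 -> phi k.+1 x (h t)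
    & forall t, `|t| = 1 -> h t = g t].

(** The default [g] makes the recursion below total; that fillings exist for the cells in use is
    shown afterwards, in [cell_extends]. *)
Definition fill_cell x k (g : 'rV[R]_k.+1 -> Y) : 'rV[R]_k.+1 -> Y :=
  if pselect (exists h, cell_filling x g h) is left e then projT1 (cid e) else g.

(** The number [m] bounds the length of the list. A list of length [m] is evaluated by a filling of
    the boundary values, where normalisation has removed at least one entry; away from the boundary
    the values of the function being filled are irrelevant. *)
Fixpoint cell_rec m (p : X * seq (X * R)) : Y :=
  if m isn't k.+1 then y0 p.1
  else if size p.2 == k.+1 then
    fill_cell p.1 (fun t : 'rV[R]_k.+1 =>
      cell_rec k (cell_normal p.1 (zip (unzip1 p.2) (row_seq t))))
      (seq_row k.+1 (unzip2 p.2))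
  else cell_rec k p.

Definition cell_map x l :=
  cell_rec (size (cell_normal x l).2) (cell_normal x l).

Lemma cell_map_on x l1 y l2 : cell_map x (l1 ++ (y, 1) :: l2) = cell_map y l2.
Proof.
have nE : cell_normal x (l1 ++ (y, 1) :: l2) = cell_normal y l2.
  by rewrite /cell_normal foldl_cat /=; congr foldl; rewrite /cell_step /= eqxx.
by rewrite /cell_map nE.
Qed.

Lemma cell_step_off p y : cell_step p (y, -1) = p.
Proof.
have N11 : (-1 == 1 :> R) = false.
  by apply/negbTE; rewrite -subr_eq0 -opprD oppr_eq0 -[1 + 1]/(2%:R) pnatr_eq0.
by rewrite /cell_step /= N11 eqxx.
Qed.

Lemma cell_map_off x l1 y l2 :
  cell_map x (l1 ++ (y, -1) :: l2) = cell_map x (l1 ++ l2).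
Proof. by rewrite /cell_map /cell_normal !foldl_cat /= cell_step_off. Qed.

Lemma cell_rec_size m p : (size p.2 <= m)%N ->
  cell_rec m p = cell_rec (size p.2) p.
Proof.
elim: m => [|m IH]; first by rewrite leqn0 => /eqP ->.
rewrite leq_eqVlt => /orP[/eqP -> //|pm].
by rewrite /= ltn_eqF // IH.
Qed.

Lemma foldl_cell_step_size p l :
  (size (foldl cell_step p l).2 <= size p.2 + size l)%N.
Proof.
elim: l p => [|q l IH] p /=; first by rewrite addn0.
apply: leq_trans (IH _) _; rewrite addnS -addSn leq_add2r /cell_step.
by case: ifP => // _; case: ifP => //= _; rewrite size_rcons.
Qed.

(** A parameter 1 restarts the list and a parameter -1 is skipped, so neither entry is kept. Hence
    boundary points fall under the recursive call of [cell_rec]. *)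
Lemma cell_normal_size x l1 q l2 : `|q.2| = 1 ->
  (size (cell_normal x (l1 ++ q :: l2)).2 <= size (l1 ++ l2))%N.
Proof.
move=> q1; rewrite /cell_normal foldl_cat /=.
apply: leq_trans (foldl_cell_step_size _ _) _; rewrite size_cat leq_add2r.
move: q1; rewrite /cell_step => /eqP; rewrite eqr_norml => /andP[].
case: ifP => // _ /= /eqP qN1 _; rewrite ifT ?qN1 //.
exact: leq_trans (foldl_cell_step_size _ _) _.
Qed.

Lemma foldl_cell_step_id x a l :
    {in l, forall q, `|q.2| < 1} ->
  foldl cell_step (x, a) l = (x, a ++ l).
Proof.
elim: l a => [|q l IH] a ql /=; first by rewrite cats0.
have : `|q.2| < 1 by apply: ql; exact: mem_head.
rewrite /cell_step; case: eqP => [->|_]; first by rewrite normr1 ltxx.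
case: eqP => [->|_]; first by rewrite normrN1 ltxx.
move=> _; rewrite IH /=; first by rewrite cat_rcons.
by move=> q' q'l; apply: ql; rewrite inE q'l orbT.
Qed.

Lemma zip_split (s : seq X) (r : seq R) x i : size r = size s ->
    (i < size s)%N ->
  zip s r = zip (take i s) (take i r) ++
    (nth x s i, r`_i) :: zip (drop i.+1 s) (drop i.+1 r).
Proof.
move=> rs si; rewrite -{1}(cat_take_drop i s) -{1}(cat_take_drop i r) zip_cat.
  by rewrite (drop_nth x) // (drop_nth 0) ?rs.
by rewrite !size_take rs.
Qed.

Lemma zip_remove (s : seq X) (r : seq R) i : size r = size s ->
  zip (take i s) (take i r) ++ zip (drop i.+1 s) (drop i.+1 r) =
  zip (take i s ++ drop i.+1 s) (take i r ++ drop i.+1 r).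
Proof. by move=> rs; rewrite zip_cat // !size_take rs. Qed.

(** A constant map of the sphere extends over the ball with values in the next set, and the
    extension keeps that constant value on the nonempty sphere. *)
Lemma phi_mono m n x : (m <= n)%N -> phi m x `<=` phi n x.
Proof.
move=> /subnK <-; elim: (n - m)%N => [|d IH] // y /IH py; rewrite addSn.
have [||h [_ hphi hy]] := @phi_aspherical (d + m)%N x (fun=> y).
- apply/within_continuousP => z _ N /nbhs_singleton Ny.
  exact: (@nearW _ (nbhs z) _ (nbhs_filter z) (fun=> fun=> Ny)).
- by [].
have [w Sw] := sphere_nonempty R (d + m).
rewrite -(hy w Sw); apply: hphi; apply/unit_ballE.
by move/sphereE: Sw => ->.
Qed.

Definition unit_functions (T : topologicalType) (A : set T) (u : seq (T -> R)) :=
  forall v, v \in u -> {within A, continuous v} /\ forall z, A z -> `|v z| <= 1.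

(** Composing with arbitrary parameter functions avoids a topology on lists and applies alike to
    faces of cubes, to a compact product and to [X]. *)
Definition cell_continuous x (s : seq X) :=
  forall (T : topologicalType) (A : set T) (u : seq (T -> R)),
    size u = size s -> unit_functions A u ->
    {within A, continuous (fun z => cell_map x (zip s [seq v z | v <- u]))}.

(** The point [x'] may differ from [x], since a cell built at a centre is also used at points near
    that centre. *)
Definition cell_values x (s : seq X) x' :=
  forall r : seq R, size r = size s -> {in r, forall a, `|a| <= 1} ->
    phi (size s) x' (cell_map x (zip s r)).

(** On the boundary the normal form is shorter, so the recursive values [g] agree with the cell map.
    In the interior the list is already normal and the cell map is the chosen filling. *)
Lemma cell_map_filling x (s : seq X) k : size s = k.+1 ->
    {within [set t : 'rV[R]_k.+1 | `|t| = 1],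
      continuous (fun t => cell_map x (zip s (row_seq t)))} ->
    (forall t : 'rV[R]_k.+1, `|t| = 1 ->
      phi k x (cell_map x (zip s (row_seq t)))) ->
  exists2 h : 'rV[R]_k.+1 -> Y,
    {within [set t | `|t| <= 1], continuous h} /\
    (forall t, `|t| <= 1 -> phi k.+1 x (h t)) &
    forall t, `|t| <= 1 -> cell_map x (zip s (row_seq t)) = h t.
Proof.
move=> sk cg gphi.
pose g (t : 'rV[R]_k.+1) := cell_rec k (cell_normal x (zip s (row_seq t))).
have gE t : `|t| = 1 -> g t = cell_map x (zip s (row_seq t)).
  move=> t1; rewrite /g /cell_map cell_rec_size //.
  have [i ti] : exists i, `|t 0 i| = 1.
    apply/not_existsP => tN1; have : `|t| < 1; last by rewrite t1 ltxx.
    apply: norm_row_lt1 => i; rewrite lt_neqAle; apply/andP; split.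
      by apply/eqP; exact: tN1.
    by move: i; apply/norm_row_le; rewrite ?t1.
  rewrite (@zip_split s _ x i) ?size_row_seq ?sk //.
  apply: leq_trans (cell_normal_size _ _ _ _) _; first by rewrite /= nth_row_seq.
  rewrite size_cat !size_zip !size_take !size_drop size_row_seq sk ltn_ord minnn.
  by rewrite minnn subSS subnKC // -ltnS.
have [h hP] : exists h, cell_filling x g h.
  apply: (@cube_extends R Y k _ _ (@phi_aspherical k x) g).
    apply: (subspace_eq_continuous _ cg) => t; rewrite inE => t1.
    by rewrite /from_subspace gE.
  by move=> t t1; rewrite gE //; exact: gphi.
have [cf fphi fg] : cell_filling x g (fill_cell x g).
  rewrite /fill_cell; case: pselect => [e|[]]; last by exists h.
  exact: projT2 (cid e).
exists (fill_cell x g) => // t; rewrite le_eqVlt => /orP[/eqP t1|t1].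
  by rewrite fg // gE.
rewrite /cell_map /cell_normal foldl_cell_step_id.
  rewrite cat0s /= size_zip size_row_seq sk minnn /= size_zip size_row_seq sk minnn eqxx.
  by rewrite unzip1_zip ?unzip2_zip ?size_row_seq ?sk // row_seqK.
move=> [y a] /= /(map_f snd) /=; rewrite -/(unzip2 _) unzip2_zip ?size_row_seq ?sk //.
move=> /mapP[i _ ->]; apply: le_lt_trans t1.
by move: i; apply/norm_row_le.
Qed.

Lemma within_continuous_seq_row (T : topologicalType) (A : set T)
    (u : seq (T -> R)) n (h : 'rV[R]_n.+1 -> Y) : unit_functions A u ->
    {within [set t | `|t| <= 1], continuous h} ->
  {within A, continuous (fun z => h (seq_row n.+1 [seq v z | v <- u]))}.
Proof.
move=> uA ch; apply/within_continuousP => z Az.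
pose L z := seq_row n.+1 [seq v z | v <- u].
have nthL z' i : L z' 0 i = nth (fun=> 0) u i z'.
  rewrite mxE; have [ui|ui] := ltnP i (size u); first by rewrite (nth_map (fun=> 0)).
  by rewrite !nth_default // size_map.
have L1 z' : A z' -> `|L z'| <= 1.
  move=> Az'; apply/norm_row_le => // i; rewrite nthL.
  have [ui|ui] := ltnP i (size u); last by rewrite nth_default // normr0.
  by have [_] := uA _ (mem_nth (fun=> 0) ui); exact.
have cL : L z' @[z' --> within A (nbhs z)] --> L z.
  apply/cvgrPdist_lt => e e0.
  have : \forall z' \near within A (nbhs z),
      forall i, [set: 'I_n.+1] i -> `|L z 0 i - L z' 0 i| < e.
    apply: near_finite_set => [|i _]; first exact: finite_finset.
    have [ui|ui] := ltnP i (size u); last first.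
      by near=> z'; rewrite !nthL !nth_default // subrr normr0.
    have [/subspace_continuousP/(_ z Az) + _] := uA _ (mem_nth (fun=> 0) ui).
    move=> /cvgrPdist_lt/(_ e e0); apply: filterS => z'.
    by rewrite !nthL.
  apply: filterS => z' Hz'; rewrite [ltLHS]mx_normrE; apply: bigmax_lt => // -[i j] _ /=.
  by rewrite (ord1 i) !mxE; have := Hz' j I; rewrite !mxE.
move=> N /((within_continuousP _ _).1 ch _ (L1 z Az)) /cL.
apply: (@filterS _ (nbhs z)) => z' NL Az'; exact: (NL Az' (L1 _ Az')).
Unshelve. all: by end_near. Qed.

(** The hypotheses concern the faces of the cube: the parameter -1 of [y] leaves the cell at [x] on
    [s1 ++ s2], and the parameter 1 the cell at [y] on [s2]. Pasting these faces gives a continuous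
    boundary map, which asphericity fills. *)
Lemma cell_extends x (s : seq X) :
    (forall s1 y s2, s = s1 ++ y :: s2 ->
      [/\ cell_continuous x (s1 ++ s2), cell_values x (s1 ++ s2) x,
          cell_continuous y s2 & cell_values y s2 x]) ->
  cell_continuous x s /\ cell_values x s x.
Proof.
move=> faces; case sE: (size s) => [|k].
  move/size0nil: sE => ->; split=> [T A u _ _|r /size0nil -> _]; last exact: phi_y0.
  have zip0 z : zip [::] [seq v z | v <- u] = [::] :> seq (X * R).
    by case: [seq v z | v <- u].
  apply/within_continuousP => z _ N /nbhs_singleton; rewrite zip0 => Ny.
  by apply: nearW => z' _; rewrite zip0.
have facesi i : (i < k.+1)%N ->
    [/\ cell_continuous x (take i s ++ drop i.+1 s),
        cell_values x (take i s ++ drop i.+1 s) x,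
        cell_continuous (nth x s i) (drop i.+1 s) &
        cell_values (nth x s i) (drop i.+1 s) x].
  by move=> ik; apply: faces; rewrite -drop_nth ?sE // cat_take_drop.
pose coords : seq ('rV[R]_k.+1 -> R) :=
  [seq (fun t : 'rV[R]_k.+1 => t 0 i) | i <- enum 'I_k.+1].
have sc : size coords = k.+1 by rewrite size_map size_enum_ord.
have row_coords t : row_seq t = [seq v t | v <- coords] by rewrite -map_comp.
have cc i : continuous (fun t : 'rV[R]_k.+1 => t 0 i) by exact: coord_continuous.
have unitc (A : set 'rV[R]_k.+1) u : A `<=` [set t | `|t| <= 1] ->
    {subset u <= coords} -> unit_functions A u.
  move=> A1 uc v /uc /mapP[i _ ->]; split; first exact: continuous_subspaceT.
  by move=> t At; move: i; apply/norm_row_le => //; exact: A1.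
have take_drop_sub i : {subset take i coords ++ drop i.+1 coords <= coords}.
  by move=> v; rewrite mem_cat => /orP[/mem_take|/mem_drop].
pose F (ib : 'I_k.+1 * bool) := [set t : 'rV[R]_k.+1 | `|t| <= 1] `&`
  [set t | t 0 ib.1 = if ib.2 then 1 else -1].
have bdE : [set t : 'rV[R]_k.+1 | `|t| = 1] = \bigcup_ib F ib.
  apply/seteqP; split=> t.
    move=> /= t1; apply/not_notP => nF; have : `|t| < 1; last by rewrite t1 ltxx.
    apply: norm_row_lt1 => i; rewrite lt_neqAle; apply/andP; split; last first.
      by move: i; apply/norm_row_le; rewrite ?t1.
    apply/negP; rewrite eqr_norml => /andP[/orP[]/eqP ti _]; apply: nF.
      by exists (i, true) => //; split=> //=; rewrite t1.
    by exists (i, false) => //; split=> //=; rewrite t1.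
  move=> [[i b] _ [/= t1 ti]]; apply/eqP; rewrite eq_le t1 /=.
  have : `|t 0 i| <= `|t| by move: i {ti}; apply/norm_row_le.
  by rewrite ti; case: b {ti}; rewrite ?normrN1 ?normr1.
have FE i b t : F (i, b) t -> cell_map x (zip s (row_seq t)) =
    if b then cell_map (nth x s i) (zip (drop i.+1 s) (drop i.+1 (row_seq t)))
    else cell_map x (zip (take i s ++ drop i.+1 s)
                         (take i (row_seq t) ++ drop i.+1 (row_seq t))).
  move=> [_ /= ti]; rewrite (@zip_split s _ x i) ?size_row_seq ?sE // nth_row_seq ti.
  case: b {ti}; first exact: cell_map_on.
  by rewrite cell_map_off zip_remove // size_row_seq sE.
have size_td (T : Type) (r : seq T) i : size r = k.+1 -> (i < k.+1)%N ->
    size (take i r ++ drop i.+1 r) = k.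
  move=> rk ik; rewrite size_cat size_take size_drop rk ik subSS subnKC //.
have [||h [ch hphi] hE] := @cell_map_filling x s k sE.
- rewrite bdE; apply: within_continuous_bigcup => -[i b].
    apply: closedI.
      by apply: (@preimage_closed _ _ (fun t : 'rV[R]_k.+1 => `|t|) [set a | a <= 1]);
        [move=> t _; exact: norm_continuous|exact: closed_le].
    by apply: (@preimage_closed _ _ (fun t : 'rV[R]_k.+1 => t 0 i)
      [set if b then 1 else -1]); [move=> t _; exact: cc|exact: closed_eq].
  have [c1 _ c2 _] := facesi i (ltn_ord i).
  case: b.
    apply: (subspace_eq_continuous _ (c2 _ (F (i, true)) (drop i.+1 coords) _ _)).
    + move=> t; rewrite inE => /FE; rewrite /from_subspace => ->.
      by rewrite row_coords map_drop.
    + by rewrite !size_drop sc sE.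
    + by apply: unitc; [move=> t []|move=> v /mem_drop].
  apply: (subspace_eq_continuous _
    (c1 _ (F (i, false)) (take i coords ++ drop i.+1 coords) _ _)).
  + move=> t; rewrite inE => /FE; rewrite /from_subspace => ->.
    by rewrite row_coords map_cat map_drop map_take.
  + by rewrite !size_td.
  + by apply: unitc; [move=> t []|exact: take_drop_sub].
- move=> t; rewrite -/([set t : 'rV[R]_k.+1 | `|t| = 1] t) bdE => -[[i b] _ Ft].
  have [_ v1 _ v2] := facesi i (ltn_ord i).
  have t1 a : a \in row_seq t -> `|a| <= 1.
    by move=> /mapP[j _ ->]; move: j; apply/norm_row_le => //; have [] := Ft.
  rewrite (FE _ _ _ Ft); case: b Ft => Ft.
    have := v2 (drop i.+1 (row_seq t)); rewrite !size_drop size_row_seq sE.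
    (* A face with parameter 1 keeps only the centres after the [i]-th, so its values lie in a
       possibly smaller set of the sequence. *)
    move=> /(_ erefl) H; apply: (@phi_mono (k.+1 - i.+1)).
      by rewrite subSS leq_subr.
    by apply: H => a /mem_drop; exact: t1.
  have := v1 (take i (row_seq t) ++ drop i.+1 (row_seq t)).
  rewrite !size_td ?size_row_seq // => /(_ erefl); apply => a.
  by rewrite mem_cat => /orP[/mem_take|/mem_drop]; exact: t1.
split.
- move=> T A u us uA.
  apply: (subspace_eq_continuous _ (within_continuous_seq_row uA ch)) => z.
  rewrite inE => Az; rewrite /from_subspace -hE.
    by rewrite seq_rowK // size_map us.
  apply/norm_row_le => // i; rewrite mxE.
  have [ui|ui] := ltnP i (size u); last by rewrite nth_default ?normr0 // size_map.
  rewrite (nth_map (fun=> 0)) //.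
  by have [_] := uA _ (mem_nth (fun=> 0) ui); exact.
- move=> r rs r1; rewrite sE -(@seq_rowK R k.+1 r) ?rs // hE.
    apply: hphi; apply/norm_row_le => // i; rewrite mxE.
    by apply: r1; rewrite mem_nth // rs sE.
  apply/norm_row_le => // i; rewrite mxE.
  by apply: r1; rewrite mem_nth // rs sE.
Qed.

(** Lower local constancy speaks of compact sets; the image of the cube turns it into a statement
    about [cell_values]. *)
Lemma cell_image_compact x s : cell_continuous x s ->
  exists2 K, compact K &
    (forall x', K `<=` phi (size s) x' <-> cell_values x s x').
Proof.
move=> cs.
(* A countable power of the segment serves for all lengths at once; only its first [size s]
   coordinates enter. *)
pose T : topologicalType := prod_topology (fun _ : nat => (R : topologicalType)).
pose A : set T := [set f | forall i, [set` `[(-1 : R), 1]] (f i)].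
have cA : compact A.
  apply: (@tychonoff nat (fun=> R : topologicalType)
    (fun=> [set` `[(-1 : R), 1]])) => i.
  exact: segment_compact.
pose u : seq (T -> R) := [seq (fun f : T => f i) | i <- iota 0 (size s)].
pose h f := cell_map x (zip s [seq v f | v <- u]).
have itvP (a : R) : [set` `[(-1 : R), 1]] a <-> `|a| <= 1.
  by rewrite /= in_itv /= ler_norml.
have ch : {within A, continuous h}.
  apply: cs; first by rewrite size_map size_iota.
  move=> v /mapP[i _ ->]; split; last by move=> f Af; exact/itvP.
  by apply: continuous_subspaceT; exact: proj_continuous.
exists (h @` A); first exact: continuous_compact ch cA.
move=> x'; split.
  move=> hA r rs r1; apply: hA; exists (fun i => r`_i).
    move=> i; apply/itvP; have [ri|ri] := ltnP i (size r).
      by apply: r1; exact: mem_nth.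
    by rewrite nth_default // normr0.
  rewrite /h /u -map_comp; congr (cell_map x (zip s _)).
  by rewrite -rs -[RHS]take_size -(map_nth_iota0 0 (leqnn _)).
move=> vs _ [f Af <-]; apply: vs; first by rewrite !size_map size_iota.
by move=> _ /mapP[_ /mapP[i _ ->] ->]; exact/itvP.
Qed.

(** * Finite systems of cells and the covers they determine *)

Hypothesis phi_llc : forall n, lower_locally_constant (phi n).
Hypothesis pX : paracompact X.
Hypothesis hX : hausdorff_space X.
Variable x0 : X.

(* F x is the set of cells at x built from the covers constructed so far; in a
   cell y_1, ..., y_m the centre y_i comes from a later cover than y_(i+1). *)
Definition face_system (F : X -> set (seq X)) :=
  [/\ forall x, finite_set (F x),
      forall x, \forall x' \near x, F x' `<=` F x,
      forall x s, F x s -> cell_continuous x s /\ cell_values x s x,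
      forall x s1 y s2, F x (s1 ++ y :: s2) -> F x (s1 ++ s2)
    & forall x s1 y s2, F x (s1 ++ y :: s2) ->
        cell_continuous y s2 /\ cell_values y s2 x].

(** This is what putting [y] in front of the cells at [x] requires: the face with parameter 1 at [y]
    must be a cell at [y] whose values are admissible at [x]. *)
Definition stable_set (F : X -> set (seq X)) y :=
  [set x | F x `<=` F y /\ forall s, F y s -> cell_values y s x].

(** There are finitely many cells at [y], each with a compact image, so lower local constancy
    applies to all of them at once. *)
Lemma stable_set_nbhs F y : face_system F -> nbhs y (stable_set F y).
Proof.
move=> [finF nearF validF _ _]; apply: filterI; first exact: nearF.
apply: (near_finite_set (nbhs_filter y) (finF y)) => s Fys.
have [cs vs] := validF _ _ Fys; have [K cK Kphi] := cell_image_compact cs.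
have : nbhs y [set x | K `<=` phi (size s) x].
  by apply: open_nbhs_nbhs; split; [exact: phi_llc|exact/Kphi].
by apply: filterS => x /Kphi.
Qed.

Definition face_cover (F : X -> set (seq X))
    (Dc : set (set X) * (set X -> X)) :=
  [/\ open_cover Dc.1, locally_finite Dc.1
    & forall A, Dc.1 A -> closure A `<=` stable_set F (Dc.2 A)].

(** With closures, every cell at a point near [x] is also a cell at [x]. *)
Definition next_faces (F : X -> set (seq X))
    (Dc : set (set X) * (set X -> X)) x :=
  F x `|` [set Dc.2 p.1 :: p.2 | p in [set A | Dc.1 A /\ closure A x] `*` F x].

Lemma face_cover_exists F : face_system F -> exists Dc, face_cover F Dc.
Proof.
move=> sysF; have [|D [c [oD lfD Dc]]] :=
    @locally_finite_shrinking _ pX hX X x0 (stable_set F).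
  by move=> x; exists x; exact: stable_set_nbhs.
by exists (D, c).
Qed.

(** By induction on length: deleting a centre gives a shorter cell at [x]. Restarting at a new
    centre gives a cell of [F] at that centre, with values admissible at [x] because [x] lies in the
    stable set. *)
Lemma next_face_system F Dc : face_system F -> face_cover F Dc ->
  face_system (next_faces F Dc).
Proof.
move=> [finF nearF validF removeF cutF] [_ lfD DcF].
have remove x s1 y s2 : next_faces F Dc x (s1 ++ y :: s2) ->
    next_faces F Dc x (s1 ++ s2).
  move=> [/removeF Fs|[[A s] /= [[DA Ax] Fs]]]; first by left.
  case: s1 => [[_ <-]|z s1 [<- sE]]; first by left.
  right; exists (A, s1 ++ s2) => //; split=> //=.
  by apply: (removeF _ _ y); rewrite -sE.
have cut x s1 y s2 : next_faces F Dc x (s1 ++ y :: s2) ->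
    cell_continuous y s2 /\ cell_values y s2 x.
  move=> [/cutF //|[[A s] /= [[DA Ax] Fs]]].
  case: s1 => [[<- <-]|z s1 [_ sE]]; last by apply: (cutF _ s1); rewrite -sE.
  have [/(_ _ Fs) FAs /(_ _ FAs) vs] := DcF _ DA _ Ax.
  by have [cs _] := validF _ _ FAs.
split=> //.
- move=> x; rewrite finite_setU; split=> //.
  apply/finite_image/finite_setX => //.
  exact: locally_finite_closure_finite.
- move=> x; apply: filterS2 (locally_finite_closure_near lfD x) (nearF x).
  move=> x' Dx' Fx' s [/Fx' Fs|[[A s'] /= [[DA Ax] /Fx' Fs] <-]]; first by left.
  by right; exists (A, s') => //; split=> //; split=> //; exact: Dx'.
- move=> x s; have [n] := ubnP (size s); elim: n s => // n IH s sn Fs.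
  apply: cell_extends => s1 y s2 sE; rewrite sE in Fs sn.
  have [c1 v1] : cell_continuous x (s1 ++ s2) /\ cell_values x (s1 ++ s2) x.
    apply: IH; last exact: remove Fs.
    by move: sn; rewrite !size_cat /= addnS.
  by have [c2 v2] := cut _ _ _ _ Fs; split.
Qed.

Lemma nil_face_system : face_system (fun=> [set [::]]).
Proof.
split=> [x|x|x s ->|x s1 y s2|x s1 y s2].
- exact: finite_set1.
- by apply: nearW => x'.
- by apply: cell_extends => -[].
- by case: s1.
- by case: s1.
Qed.

(** * Gluing the cell maps into a selection *)

Lemma C_space_selection : C_space X -> exists f : X -> Y,
  continuous f /\ selection (fun x => \bigcup_n phi n x) f.
Proof.
move=> CX.
(* Choosing a value for every [F], with a default off face systems, lets the sequence be defined by
   plain recursion before its validity is proved. *)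
have [cov covP] : exists cov, forall F, face_system F -> face_cover F (cov F).
  have exF F : exists Dc, face_system F -> face_cover F Dc.
    have [/face_cover_exists[Dc DcP]|nF] := pselect (face_system F).
      by exists Dc.
    by exists (set0, fun=> x0).
  by have [cov covP] := choice exF; exists cov.
pose F := fix F n := if n is k.+1 then next_faces (F k) (cov (F k))
                     else (fun=> [set [::]]).
have sysF n : face_system (F n).
  elim: n => [|n IH]; first exact: nil_face_system.
  by apply: next_face_system => //; exact: covP.
pose D n := (cov (F n)).1; pose c n := (cov (F n)).2.
have DP n : [/\ open_cover (D n), locally_finite (D n)
    & forall A, D n A -> closure A `<=` stable_set (F n) (c n A)].
  exact: covP.
have [V [oV trV refV cV]] : exists V : nat -> set (set X),
    [/\ forall n A, V n A -> open A, forall n, trivIset (V n) id,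
        forall n, refines (V n) (D n) & \bigcup_n \bigcup_(A in V n) A = setT].
  by apply: CX => n; have [] := DP n.
pose O n := \bigcup_(A in V n) A.
have oO n : open (O n) by apply: bigcup_open => A /oV.
have [t [ct t1 t_on t_off]] := subordinate_functions pX hX R oO cV.
have [g gP] : exists g : nat * set X -> set X,
    forall nB, V nB.1 nB.2 -> D nB.1 (g nB) /\ nB.2 `<=` g nB.
  have gex nB : exists A, V nB.1 nB.2 -> D nB.1 A /\ nB.2 `<=` A.
    have [/refV[A DA BA]|nVB] := pselect (V nB.1 nB.2); first by exists A.
    by exists set0.
  by have [g gP] := choice gex; exists g.
have [B BP] : exists B : nat * X -> set X,
    forall nx, O nx.1 nx.2 -> V nx.1 (B nx) /\ B nx nx.2.
  have Bex nx : exists B, O nx.1 nx.2 -> V nx.1 B /\ B nx.2.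
    have [[B VB Bx]|nO] := pselect (O nx.1 nx.2); first by exists B.
    by exists set0.
  by have [B BP] := choice Bex; exists B.
(* Outside [O n] this centre is arbitrary, but its parameter is -1 there and the entry is
   deleted. *)
pose a n x := c n (g (n, B (n, x))).
have aD n x : O n x -> exists2 A, D n A & A x /\ a n x = c n A.
  move=> /(BP (n, x))[/= VB Bx]; have [/= DA BA] := gP (n, B (n, x)) VB.
  by exists (g (n, B (n, x))) => //; split=> //; exact: BA.
(* Points near [x] stay in the same member of [V n], the only one that contains them by
   disjointness. *)
have a_near n x : O n x -> \forall x' \near x, a n x' = a n x.
  move=> /(BP (n, x))[/= VB Bx].
  have : nbhs x (B (n, x)).
    by apply: open_nbhs_nbhs; split=> //; exact: oV VB.
  apply: filterS => x' Bx'; rewrite /a.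
  have Ox' : O n x' by exists (B (n, x)).
  have [/= VB' B'x'] := BP (n, x') Ox'.
  suff -> : B (n, x') = B (n, x) by [].
  by apply: (trV n) => //; exists x'.
pose l := fix l n x : seq (X * R) :=
  if n is k.+1 then (a k x, t k x) :: l k x else [::].
have l_cut k m x : t k x = 1 -> (k <= m)%N ->
    cell_map x (l m.+1 x) = cell_map (a k x) (l k x).
  move=> tk km.
  have [l1 ->] : exists l1, l m.+1 x = l1 ++ (a k x, 1) :: l k x.
    rewrite -tk; elim: m km => [|m IH].
      by rewrite leqn0 => /eqP ->; exists [::].
    rewrite leq_eqVlt => /orP[/eqP ->|/IH[l1 lE]]; first by exists [::].
    by exists ((a m.+1 x, t m.+1 x) :: l1); rewrite /= -lE.
  exact: cell_map_on.
have [K KP] : exists K : X -> nat, forall x, t (K x) x = 1.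
  have Kex x : exists n, t n x = 1.
    by have [n /nbhs_singleton] := t_on x; exists n.
  by have [K KP] := choice Kex; exists K.
pose f x := cell_map x (l (K x).+1 x).
(* The list up to the level [maxn k (K x)] can be cut at either level. Thus one [k] with parameter 1
   near [x] describes [f] near [x], however [K] varies. *)
have fE k x : t k x = 1 -> f x = cell_map (a k x) (l k x).
  move=> tk; have := l_cut k (maxn k (K x)) x tk (leq_maxl _ _).
  rewrite (l_cut (K x) _ _ (KP x) (leq_maxr _ _)) => <-.
  by rewrite /f (l_cut (K x)).
(* Near [x] each level either has parameter -1 and disappears, or has a constant centre. The initial
   state [p] is arbitrary because the induction removes the head of the list. *)
have local k x : exists s (u : seq (X -> R)), [/\ size u = size s, F k x s,
    unit_functions setT u & \forall x' \near x, forall p,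
      foldl cell_step p (l k x') = foldl cell_step p (zip s [seq v x' | v <- u])].
  elim: k => [|k [s [u [us Fs uT lE]]]].
    by exists [::], [::]; split=> //; exact: filterE.
  have [Okx|nOkx] := pselect (O k x); last first.
    exists s, u; split=> //; first by left.
    apply: filterS2 lE (t_off _ _ nOkx) => x' lE tk p.
    by rewrite /= tk cell_step_off lE.
  exists (a k x :: s), (t k :: u); split.
  - by rewrite /= us.
  - right; have [A DA [Ax ->]] := aD _ _ Okx.
    by exists (A, s) => //; split=> //; split=> //; exact: subset_closure.
  - move=> v; rewrite inE => /orP[/eqP ->|/uT //].
    by split=> //; apply: continuous_subspaceT; exact: ct.
  - by apply: filterS2 lE (a_near _ _ Okx) => x' lE ak p; rewrite /= ak lE.
(* Near [x] the parameter of some level is 1, so [f] is one cell map at a fixed centre composed with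
   continuous parameters. *)
have key x : exists y s (u : seq (X -> R)),
    [/\ size u = size s, unit_functions setT u, cell_continuous y s,
      cell_values y s x
      & \forall x' \near x, f x' = cell_map y (zip s [seq v x' | v <- u])].
  have [k tk] := t_on x; have [s [u [us Fs uT lE]]] := local k x.
  have Okx : O k x.
    apply/not_notP => /t_off/nbhs_singleton.
    rewrite (nbhs_singleton tk) => /eqP; rewrite -subr_eq0 opprK.
    by rewrite -[1 + 1]/(2%:R) pnatr_eq0.
  have [A DA [Ax aE]] := aD _ _ Okx; have [_ _ /(_ _ DA)] := DP k.
  move=> /(_ _ (subset_closure Ax))[/(_ _ Fs)]; rewrite -aE => Fas /(_ _ Fas) vs.
  exists (a k x), s, u; split=> //.
    by have [_ _ /(_ _ _ Fas)[]] := sysF k.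
  apply: filterS3 tk lE (a_near _ _ Okx) => x' tk lE ak.
  by rewrite (fE k) // ak /cell_map /cell_normal lE.
exists f; split=> x; have [y [s [u [us uT cs vs fx]]]] := key x.
- have /within_continuousP/(_ x I) := cs _ _ _ us uT.
  rewrite -(nbhs_singleton fx) => cx N /cx Nx.
  apply: (@filterS2 _ (nbhs x) _ _ _ _ _ fx Nx) => x' fx' /(_ I).
  by rewrite /= fx'.
- exists (size s) => //; rewrite (nbhs_singleton fx); apply: vs.
    by rewrite size_map.
  by move=> _ /mapP[v vu ->]; have [_] := uT v vu; exact.
Qed.
End Cells.

Theorem corollary6p2 (R : realType) (X : topologicalType)
    (pX : paracompact X) (hX : hausdorff_space X) :
  [<-> C_space X;
       forall Y : topologicalType, hausdorff_space Y ->
         forall phi : nat -> X -> set Y,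
           (forall n, set_valued (phi n)) ->
           (forall n, lower_locally_constant (phi n)) ->
           aspherical R phi ->
         exists f : X -> Y,
           continuous f /\ selection (fun x => \bigcup_n phi n x) f;
       forall U : nat -> set (set X), (forall n, open_cover (U n)) ->
         exists f : X -> realisation R (Delta U), canonical_map f].
Proof.
tfae; last exact: canonical_C_space.
- move=> CX Y hY phi phi0 phi_llc phi_asph.
  have [y0 y0P] : exists y0 : X -> Y, forall x, phi 0 x (y0 x).
    by have [y0 y0P] := choice (phi0 0%N); exists y0.
  (* The point [x0] serves as a default centre; on an empty space [y0] is vacuously a continuous
     selection. *)
  have [[x0 _]|X0] := pselect (exists x : X, True).
    exact: (C_space_selection phi_asph y0P phi_llc pX hX x0 CX).
  by exists y0; split=> x; exfalso; apply: X0; exists x.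
- exact: selection_canonical.
Qed.
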